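(* For all integers $n\ge0$, $$\varepsilon_1(n,3)=\frac{808n^2+99n-454}{3003}\binom{2n+1}{n}\binom{n+1}{5}.$$
   Context: Gluings. An $m$-gon ($m\ge1$) is a disk with $m$ marked points (vertices) on its boundary circle, which divide the counterclockwise oriented circle into $m$ arcs (edges); $1$-gons and $2$-gons are allowed. For $n\ge1$ and positive integers $m_1,\dots,m_k$ with $m_1+\dots+m_k=2n$, take $k$ distinguishable (numbered) polygons $D_1,\dots,D_k$, where $D_i$ is an $m_i$-gon with one distinguished edge (so all $2n$ edges are distinguishable). A gluing is a partition of the $2n$ edges into $n$ pairs, the two edges in each pair being identified with opposite orientations; the result is a compact orientable surface without boundary. $\varepsilon_g(m_1,\dots,m_k;k)$ is the number of gluings giving a connected surface of genus $g$, and $\varepsilon_g(n,k)=\sum_{m_1+\dots+m_k=2n}\varepsilon_g(m_1,\dots,m_k;k)$, the sum being over all $k$-tuples of positive integers. Equivalently, for $n\ge 1$, $\varepsilon_g(m_1,\dots,m_k;k)$ is the number of fixed-point-free involutions $\iota\in S_{2n}$ such that, for the permutation $\tau\in S_{2n}$ with cycles formed by successive blocks of consecutive integers of lengths $m_1,\dots,m_k$ (each block cyclically permuted in increasing order), the group $\langle\iota,\tau\rangle$ is transitive and $\tau\iota$ has exactly $n-k+2-2g$ cycles. For $n=0$: $\varepsilon_0(0,1)=1$ and $\varepsilon_g(0,k)=0$ if $g+k>1$. Binomial coefficients $\binom{a}{b}$ with $0\le a<b$ are $0$. *)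

(* Defs.v *)
From HB Require Import structures.
From mathcomp Require Import all_boot all_order all_algebra all_fingroup.

Set Implicit Arguments.
Unset Strict Implicit.
Unset Printing Implicit Defensive.

Section Gluings.

Variables (k : nat) (m : 'I_k -> nat).

(* Tagged i j is the j-th edge, counterclockwise from the distinguished edge
   j = 0, of the (m i)-gon D_i.  Listing the edges lexicographically identifies
   this type with the index set of S_2n, 2n = \sum_i m i, and the polygons with
   successive blocks of lengths m_1, ..., m_k. *)
Definition edge : finType := {i : 'I_k & 'I_(m i)}.

Definition next_edge (e : edge) : edge :=
  Tagged (fun i => 'I_(m i)) (ordS (tagged e)).

Lemma next_edge_inj : injective next_edge.
Proof.
apply: (can_inj (g := fun e => Tagged (fun i => 'I_(m i)) (ord_pred (tagged e)))).
by case=> i x; rewrite /next_edge /= ordSK.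
Qed.

Definition tau : {perm edge} := perm next_edge_inj.

(* A partition of the edges into pairs is encoded as the involution swapping
   the two edges of each pair. *)
Definition is_gluing (iota : {perm edge}) : bool :=
  [forall e, (iota e != e) && (iota (iota e) == e)].

Definition glued_connected (iota : {perm edge}) : bool :=
  [transitive <<[set iota; tau]>>%g, on [set: edge] | 'P].

(* Products of permutations act left to right, so iota * tau is e |-> tau (iota e);
   its cycles are the vertices of the glued surface. *)
Definition num_vertices (iota : {perm edge}) : nat :=
  #|porbits (iota * tau)%g|.

(* The last condition is num_vertices iota = n - k + 2 - 2 g, rearranged to avoid
   truncated subtraction, where n is the number of pairs of edges. *)
Definition epsilon_polygons (g : nat) : nat :=
  let n := (\sum_(i < k) m i)./2 in
  #|[set iota : {perm edge} | [&& is_gluing iota, glued_connected iota &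
      num_vertices iota + k + 2 * g == n + 2]]|.

End Gluings.

(* For n = 0 the value is conventional: a single sphere.  For n > 0 the sum runs
   over all k-tuples of positive integers with sum 2n; the bound 2n on each
   entry is automatic. *)
Definition epsilon (g n k : nat) : nat :=
  if n == 0 then (g == 0) && (k == 1) : nat
  else \sum_(m : {ffun 'I_k -> 'I_(2 * n).+1} |
               [forall i, 0 < m i] && (\sum_(i < k) m i == 2 * n))
         epsilon_polygons (fun i => m i : nat) g.

(* Main.v *)
Require Import Defs.
From HB Require Import structures.
From mathcomp Require Import all_boot all_order all_algebra all_fingroup.
From mathcomp Require Import qpoly ssrcomplements mpoly ring lra zify.
Import Order.TTheory GRing.Theory Num.Theory.
Set Implicit Arguments.
Unset Strict Implicit.
Unset Printing Implicit Defensive.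
Local Open Scope ring_scope.

(** The proof weights a gluing by N to the number of its vertices, for a positive
    integer N.  Summed over all gluings of polygons with m_1, ..., m_k edges,
    connected or not, the weights give the mean of p_(m_1) ... p_(m_k) in the
    Gaussian unitary ensemble of size N, where p_m is the m-th power sum of the
    eigenvalues (pairing_sumE).  Both sides obey the same recurrence: removing the
    pair that contains a given edge either splits its polygon into two or merges it
    with another one, and these are the two kinds of terms of the loop equation
    (trace_mean_loop).  The ensemble enters only algebraically, as a linear
    functional on polynomials in N variables: the Gaussian functional weighted by
    the square of the Vandermonde product.

    The loop equations close up when they are summed over all sizes of the polygons.
    The sum over pairs of polygons with 2n edges is the mean of one polygon with
    2n + 2 edges (trace_mean_loop1), and the sum over triples is a linear combination
    of means of one polygon (triangle_sum_T3).  So the numbers for three polygons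
    follow from those for one polygon.  The latter are moments of the Hermite kernel
    (trace_mean_power_sum), for which integration by parts gives the three-term
    recurrence of Harer and Zagier (kernel_moment_rec); it yields closed forms for the
    genera 0, 1, 2 and 3.

    The connected gluings of three polygons are counted by the joint cumulant
    (connected_sum), and genus one is the coefficient of N^(n - 3) in it.  This
    coefficient combines the generating functions of the genera up to 3
    (three_faces_genus1).  Put r = (1 - 4 x)^(-1/2).  The series of genus 1, 2
    and 3 are odd powers of r with polynomial coefficients.  The Catalan series of
    genus 0 is not, but it cancels (three_faces_identity): apart from a multiple of the
    genus 2 numbers, what is left is the coefficient of x^(n + 2) in
    x^6 r^15 (1485 + 6012 x + 1614 x^2).  This is a central binomial coefficient times
    a polynomial in n, and so is the formula of the theorem. *)

(** * One-dimensional Gaussian moments and Hermite polynomials *)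

Fixpoint gauss_moment (k : nat) : rat :=
  match k with
  | 0 => 1
  | 1 => 0
  | j.+2 => j.+1%:R * gauss_moment j
  end.

Lemma gauss_momentS k : gauss_moment k.+1 = k%:R * gauss_moment k.-1.
Proof. by case: k => [|k] //=; rewrite mul0r. Qed.

(** The mean of p at a standard normal variable. *)
Definition gauss1 (p : {poly rat}) : rat :=
  \sum_(i < size p) p`_i * gauss_moment i.

Lemma gauss1E K (p : {poly rat}) : (size p <= K)%N ->
  gauss1 p = \sum_(i < K) p`_i * gauss_moment i.
Proof.
move=> le_pK; rewrite /gauss1 (big_ord_widen _ (fun i => p`_i * gauss_moment i) le_pK).
rewrite big_mkcond /=; apply: eq_bigr => i _; case: ltnP => // le_pi.
by rewrite nth_default ?mul0r.
Qed.

Lemma gauss1_is_linear : linear_for *%R gauss1.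
Proof.
move=> c p q; pose K := maxn (size p) (maxn (size q) (size (c *: p + q)%R)).
have [le_p le_q le_pq] :
  [/\ size p <= K, size q <= K & size (c *: p + q)%R <= K]%N.
  by split; rewrite /K !leq_max leqnn ?orbT.
rewrite (gauss1E le_p) (gauss1E le_q) (gauss1E le_pq) mulr_sumr -big_split /=.
by apply: eq_bigr => i _; rewrite coefD coefZ; ring.
Qed.

HB.instance Definition _ :=
  GRing.isLinear.Build rat {poly rat} rat *%R gauss1 gauss1_is_linear.

Lemma gauss1Z c p : gauss1 (c *: p) = c * gauss1 p.
Proof. exact: linearZ_LR. Qed.

Lemma gauss1C c : gauss1 c%:P = c.
Proof. by rewrite (gauss1E (size_polyC_leq1 c)) big_ord1 coefC mulr1. Qed.

(** Integration by parts against the Gaussian weight. *)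
Lemma gauss1_mulX p : gauss1 ('X * p) = gauss1 p^`().
Proof.
have le_xp : (size ('X * p)%R <= (size p).+1)%N.
  by apply: leq_trans (size_polyMleq _ _) _; rewrite size_polyX add2n.
have le_dp : (size p^`() <= size p)%N.
  exact: leq_trans (size_poly _ _) (leq_pred _).
rewrite (gauss1E le_xp) (gauss1E le_dp) big_ord_recl /= coefXM mul0r add0r.
case sz_p: (size p) => [|k]; first by rewrite !big_ord0.
rewrite big_ord_recl big_ord_recr /= /bump /= coefXM /= mulr0 add0r.
rewrite [X in _ = _ + X](_ : _ = 0) ?addr0; last first.
  by rewrite coef_deriv nth_default ?mul0rn ?mul0r ?sz_p.
apply: eq_bigr => i _; rewrite coefXM /= coef_deriv /= add0n -mulr_natr; ring.
Qed.

(** The monic polynomials orthogonal for the standard normal law.  With this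
    first-order recurrence, integration by parts moves a derivative off hermite n. *)
Fixpoint hermite (n : nat) : {poly rat} :=
  match n with
  | 0 => 1
  | m.+1 => 'X * hermite m - (hermite m)^`()
  end.

Lemma deriv_hermite n : (hermite n.+1)^`() = n.+1%:R *: hermite n.
Proof.
elim: n => [|n IHn]; first by rewrite /= derivC subr0 mulr1 derivX scale1r.
rewrite [hermite n.+2]/= -/(hermite n.+1) derivB derivM derivX IHn derivZ.
have eH : hermite n.+1 = 'X * hermite n - (hermite n)^`() by [].
by rewrite -[n.+2%:R]natr1 scalerDl scale1r {2}eH scalerBr scalerAr; ring.
Qed.

Lemma monic_hermite n : hermite n \is monic /\ size (hermite n) = n.+1.
Proof.
elim: n => [|n [mon sz]]; first by rewrite monic1 size_poly1.
have nz : hermite n != 0 by rewrite -size_poly_eq0 sz.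
have szX : size ('X * hermite n) = n.+2 by rewrite mulrC size_mulX ?sz.
have lt : (size (- (hermite n)^`())%R < size ('X * hermite n)%R)%N.
  by rewrite size_polyN szX; apply: leq_ltn_trans (size_poly _ _) _; rewrite sz.
by rewrite monicE /= lead_coefDl // size_polyDl // lead_coefM lead_coefX mul1r -monicE.
Qed.

Lemma gauss1_hermiteM n p : gauss1 (hermite n.+1 * p) = gauss1 (hermite n * p^`()).
Proof.
rewrite /= mulrBl raddfB /= -mulrA gauss1_mulX derivM raddfD /=.
by rewrite addrAC subrr add0r.
Qed.

(** Each integration by parts lowers both indices by one. *)
Lemma hermite_orthogonal i j :
  gauss1 (hermite i * hermite j) = (i == j)%:R * i`!%:R.
Proof.
elim: i j => [|i IHi] [|j].
- by rewrite mulr1 mul1r -(gauss1C 1).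
- by rewrite mulrC gauss1_hermiteM derivC mulr0 raddf0 mul0r.
- by rewrite gauss1_hermiteM derivC mulr0 raddf0 mul0r.
rewrite gauss1_hermiteM deriv_hermite -scalerAr gauss1Z IHi eqSS.
by case: eqP => [->|_]; rewrite ?mul0r ?mulr0 // !mul1r -natrM.
Qed.

(** * The Harer-Zagier recurrence *)

(** Times the Gaussian density, this is the eigenvalue density of the Gaussian
    unitary ensemble of size N, of total mass N. *)
Definition hermite_kernel (N : nat) : {poly rat} :=
  \sum_(j < N) (j`!%:R)^-1 *: hermite j ^+ 2.

Definition kernel_moment (N m : nat) : rat := gauss1 ('X^m * hermite_kernel N).

(** The Christoffel-Darboux telescoping, in its confluent form: differentiating
    the weighted kernel leaves a single product of consecutive polynomials. *)
Lemma deriv_hermite_kernel N :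
  (hermite_kernel N.+1)^`() =
    'X * hermite_kernel N.+1 - (N`!%:R)^-1 *: (hermite N.+1 * hermite N).
Proof.
elim: N => [|N IHN].
  rewrite /hermite_kernel big_ord1 /= derivC subr0 expr1n mulr1 invr1 !scale1r.
  by rewrite derivC mulr1 subrr.
rewrite /hermite_kernel big_ord_recr /= -/(hermite_kernel N.+1) -/(hermite N.+1).
rewrite derivD IHN derivZ expr2 derivM -/(hermite_kernel N.+1) -/(hermite N.+1).
rewrite !deriv_hermite.
have -> : (N`!%:R^-1 : rat) = (N.+1)`!%:R^-1 * N.+1%:R.
  by rewrite factS natrM invfM mulrAC mulVf ?mul1r ?pnatr_eq0.
by rewrite -!mul_polyC !polyCM; ring.
Qed.

Lemma kernel_moment0 N : kernel_moment N 0 = N%:R.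
Proof.
rewrite /kernel_moment mul1r /hermite_kernel raddf_sum /=.
rewrite -[N in RHS]card_ord -sumr_const; apply: eq_bigr => j _.
rewrite gauss1Z expr2 hermite_orthogonal eqxx mul1r mulVf //.
by rewrite pnatr_eq0 -lt0n fact_gt0.
Qed.

(** The Harer-Zagier recurrence.  Integration by parts turns the first-order system
    satisfied by He_N^2, He_N He_(N-1), He_(N-1)^2 into relations between their
    moments; the kernel enters through its derivative, where He_N He_(N-1) appears. *)
Lemma kernel_moment_rec N k :
  (k + 4)%:R * kernel_moment N (k + 2) =
    4%:R * N%:R * k.+1%:R * kernel_moment N k
    + k.+1%:R * k%:R * (k%:R - 1) * kernel_moment N (k - 2).
Proof.
case: N => [|N].
  by rewrite /kernel_moment /hermite_kernel !big_ord0 !mulr0 raddf0 !(mulr0,mul0r,addr0).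
pose A := hermite N.+1 ^+ 2; pose B := hermite N.+1 * hermite N; pose C := hermite N ^+ 2.
have partsE m (p : {poly rat}) : m%:R * gauss1 ('X^(m.-1) * p) + gauss1 ('X^m * p^`()) = gauss1 ('X^(m.+1) * p).
  rewrite exprS -mulrA gauss1_mulX derivM derivXn raddfD /=.
  by rewrite -scaler_nat -scalerAl gauss1Z.
have dH1 : (hermite N.+1)^`() = N.+1%:R *: hermite N by rewrite deriv_hermite.
have dH : (hermite N)^`() = 'X * hermite N - hermite N.+1 by rewrite /=; ring.
have dA : A^`() = (2%:R * N.+1%:R) *: B.
  by rewrite /A expr2 derivM dH1 /B -!mul_polyC polyCM; ring.
have dC : C^`() = 2%:R *: ('X * C) - 2%:R *: B.
  by rewrite /C expr2 derivM dH /B -!mul_polyC; ring.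
have dB : B^`() = N.+1%:R *: C + 'X * B - A.
  by rewrite /B /C /A derivM dH dH1 -!mul_polyC; ring.
pose a m := gauss1 ('X^m * A); pose b m := gauss1 ('X^m * B); pose c m := gauss1 ('X^m * C).
have ra m : m%:R * a m.-1 + 2%:R * N.+1%:R * b m = a m.+1.
  by rewrite -[a m.+1]partsE dA -scalerAr gauss1Z.
have rc m : c m.+1 = 2%:R * b m - m%:R * c m.-1.
  have := partsE m C; rewrite dC mulrBr raddfB /= -!scalerAr !gauss1Z.
  by rewrite [_ * ('X * C)]mulrA -exprSr -/(c _) -/(c _) -/(b _); lra.
have rb m : a m = m%:R * b m.-1 + N.+1%:R * c m.
  have := partsE m B; rewrite dB mulrBr mulrDr raddfB raddfD /= -!scalerAr !gauss1Z.
  by rewrite [_ * ('X * B)]mulrA -exprSr -/(c _) -/(b _) -/(b _) -/(a _); lra.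
pose S := kernel_moment N.+1; pose f : rat := (N`!%:R)^-1.
(* The kernel, through its derivative: its moments are those of B up to a factor. *)
have fb m : f * b m = m%:R * S m.-1.
  have := partsE m (hermite_kernel N.+1); rewrite deriv_hermite_kernel mulrBr raddfB /=.
  rewrite -!scalerAr !gauss1Z [_ * ('X * _)]mulrA -exprSr -/(b _) -/f.
  by rewrite -[gauss1 ('X^(m.-1) * _)]/(S _); lra.
(* Eliminating the moments of A leaves a recurrence for those of B, driven by C. *)
have step m : (m.+1)%:R * b m = m%:R * (m%:R - 1) * b m.-2 + 2%:R * m%:R * N.+1%:R * c m.-1.
  have h1 := ra m; have h2 := rb m.+1; have h3 := rc m; have h4 := rb m.-1.
  case: m h1 h2 h3 h4 => [|m] /= h1 h2 h3 h4.
    by move: h1 h2 h3 h4; rewrite !mul0r mulr1n; nra.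
  rewrite h2 h3 h4 in h1.
  have -> : m.+1%:R - 1 = m%:R :> rat by rewrite -natr1 addrK.
  have e1 : m.+2%:R = m%:R + 2 :> rat by rewrite -addn2 natrD.
  have e2 : m.+1%:R = m%:R + 1 :> rat by rewrite -natr1.
  by rewrite e1 e2 in h1 *; nra.
have stepS m : (m.+2)%:R * S m = m%:R * (m%:R - 1) * S m.-2 + 2%:R * N.+1%:R * (f * c m).
  have := congr1 (fun z => f * z) (step m.+1); rewrite mulrCA fb.
  rewrite mulrDr [f * (_ * b _)]mulrCA fb /=; case: m => [|m].
    by rewrite /= !mul1r => h; rewrite h; ring.
  have nz : (m.+2%:R : rat) != 0 by rewrite pnatr_eq0.
  by move=> /= h; apply: (mulfI nz); rewrite mulrCA h; ring.
have h1 := stepS k; have h2 := stepS k.+2.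
have h3 := congr1 (fun z => f * z) (rc k.+1); rewrite mulrBr mulrCA fb /= in h3.
rewrite h3 in h2; rewrite addn2 addn4 subn2 -/(S _) -/(S _) -/(S _).
have -> : k.+1%:R * k%:R * (k%:R - 1) * S k.-2 =
   k.+1%:R * (k.+2%:R * S k - 2%:R * N.+1%:R * (f * c k)) by rewrite h1; ring.
rewrite h2 /=.
have -> : k.+2%:R = k%:R + 2 :> rat by rewrite -addn2 natrD.
have -> : k.+1%:R = k%:R + 1 :> rat by rewrite -natr1.
by ring.
Qed.

(** * The Gaussian functional with squared Vandermonde weight *)

Section TraceFunctional.
Variable N : nat.
Implicit Types f g : {mpoly rat[N]}.

(** The mean of f at N independent standard normal variables. *)
Definition gauss f : rat :=
  \sum_(m <- msupp f) f@_m * \prod_(i < N) gauss_moment (m i).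

Lemma gauss_is_linear : linear_for *%R gauss.
Proof.
have gaussE k f : (msize f <= k)%N ->
    gauss f = \sum_(m : 'X_{1..N < k}) f@_m * \prod_(i < N) gauss_moment (m i).
  move=> le_fk; set I : subFinType _ := 'X_{1..N < k}.
  rewrite /gauss (big_mksub I) ?msupp_uniq //=; first last.
    by move=> x /msize_mdeg_lt /leq_trans; apply.
  by rewrite big_rmcond //= => j /memN_msupp_eq0 ->; rewrite mul0r.
move=> c f g; pose K := maxn (msize f) (maxn (msize g) (msize (c *: f + g)%R)).
have [le_f le_g le_fg] :
  [/\ msize f <= K, msize g <= K & msize (c *: f + g)%R <= K]%N.
  by split; rewrite /K !leq_max leqnn ?orbT.
rewrite (gaussE _ _ le_f) (gaussE _ _ le_g) (gaussE _ _ le_fg) mulr_sumr -big_split /=.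
by apply: eq_bigr => i _; rewrite mcoeffD mcoeffZ mulrDl mulrA.
Qed.

HB.instance Definition _ :=
  GRing.isLinear.Build rat {mpoly rat[N]} rat *%R gauss gauss_is_linear.

Lemma gaussX m : gauss 'X_[m] = \prod_(i < N) gauss_moment (m i).
Proof. by rewrite /gauss msuppX big_seq1 mcoeffX eqxx mul1r. Qed.

Lemma gaussZ c f : gauss (c *: f) = c * gauss f.
Proof. exact: linearZ_LR. Qed.

Lemma gauss_mulX (i : 'I_N) f : gauss ('X_i * f) = gauss f^`M(i).
Proof.
elim/mpolyind: f => [|c m f _ _ IHf]; first by rewrite mulr0 mderiv0 raddf0.
rewrite mulrDr mderivD !raddfD /= IHf mderivZ -scalerAr !gaussZ; congr (c * _ + _).
rewrite mderivX gaussZ -mpolyXD !gaussX (bigD1 i) //= [in RHS](bigD1 i) //=.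
rewrite mulrA mnmDE mnmBE mnm1E eqxx add1n subn1 gauss_momentS; congr (_ * _).
apply: eq_bigr => j ne_ji.
by rewrite mnmDE mnmBE mnm1E eq_sym (negbTE ne_ji) add0n subn0.
Qed.

Definition power_sum (k : nat) : {mpoly rat[N]} := \sum_(i < N) 'X_i ^+ k.

Lemma power_sum0 : power_sum 0 = N%:R.
Proof. by rewrite /power_sum (eq_bigr (fun _ => 1)) ?sumr_const ?card_ord. Qed.

(** The vector field \sum_i X_i^a d/dX_i, generating the substitutions
    X_i -> X_i + t X_i^a. *)
Definition power_field (a : nat) f : {mpoly rat[N]} :=
  \sum_(i < N) 'X_i ^+ a * f^`M(i).

Lemma power_fieldM a f g :
  power_field a (f * g) = power_field a f * g + f * power_field a g.
Proof.
rewrite /power_field mulr_suml mulr_sumr -big_split /=; apply: eq_bigr => i _.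
by rewrite mderivM; ring.
Qed.

Lemma power_field1 a : power_field a 1 = 0.
Proof. by rewrite /power_field big1 // => i _; rewrite mderivC mulr0. Qed.

Lemma power_field_prod a (I : finType) (P : pred I) (F : I -> {mpoly rat[N]}) :
  power_field a (\prod_(i | P i) F i) =
    \sum_(i | P i) power_field a (F i) * \prod_(j | P j && (j != i)) F j.
Proof.
have [n] := ubnP #|P|; elim: n P => // n IHn P le_Pn.
have [i0 Pi0|P0] := pickP P; last by rewrite !big_pred0 ?power_field1.
rewrite (bigD1 i0) //= power_fieldM IHn; last first.
  rewrite -ltnS (leq_trans _ le_Pn) // ltnS [X in (_ < X)%N](cardD1 i0) [i0 \in _]Pi0 add1n ltnS.
  by apply/subset_leq_card/subsetP => j; rewrite !inE => /andP[Pj ->].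
rewrite [RHS](bigD1 i0) //=; congr (_ + _); rewrite mulr_sumr.
apply: eq_bigr => i /andP[Pi ne_i]; rewrite mulrCA; congr (_ * _).
rewrite [RHS](bigD1 i0) /=; last by rewrite Pi0 eq_sym.
by congr (_ * _); apply: eq_bigl => j; rewrite andbAC.
Qed.

Lemma mderiv_powX (i j : 'I_N) k :
  ('X_i ^+ k : {mpoly rat[N]})^`M(j) = (k%:R * (i == j)%:R) *: 'X_i ^+ k.-1.
Proof.
elim: k => [|k IHk]; first by rewrite mderivC mul0r scale0r.
rewrite exprS mderivM IHk mderivX mnm1E /=; case: eqP => [<-|_]; last first.
  by rewrite !mulr0 !scale0r mulr0 mul0r addr0.
rewrite !mulr1 scale1r -[X in X * _](_ : 1 = _); last first.
  by rewrite -mpolyX0; congr 'X_[_]; apply/mnmP => l; rewrite mnmBE mnm0E subnn.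
case: k {IHk} => [|k]; first by rewrite scale0r mulr0 addr0 mul1r scale1r.
by rewrite mul1r -scalerAr -exprS -[k.+2%:R]natr1 scalerDl scale1r addrC.
Qed.

Lemma power_field_pow a (i : 'I_N) k :
  power_field a ('X_i ^+ k) = k%:R *: 'X_i ^+ (a + k).-1.
Proof.
rewrite /power_field (bigD1 i) //= big1 ?addr0 => [|j ne_ji]; last first.
  by rewrite mderiv_powX eq_sym (negbTE ne_ji) mulr0 scale0r mulr0.
rewrite mderiv_powX eqxx mulr1 -scalerAr -exprD.
by case: k => [|k]; rewrite ?scale0r // addnS.
Qed.

Lemma power_field_sum a (I : Type) r (P : pred I) (F : I -> {mpoly rat[N]}) :
  power_field a (\sum_(i <- r | P i) F i) = \sum_(i <- r | P i) power_field a (F i).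
Proof.
rewrite /power_field exchange_big /=; apply: eq_bigr => i _.
by rewrite raddf_sum mulr_sumr.
Qed.

Lemma power_field_power_sum a k :
  power_field a (power_sum k) = k%:R *: power_sum (a + k).-1.
Proof.
rewrite /power_sum power_field_sum scaler_sumr.
by apply: eq_bigr => i _; rewrite power_field_pow.
Qed.

Lemma gauss_power_sum a f :
  gauss (power_sum a.+1 * f) = a%:R * gauss (power_sum a.-1 * f) + gauss (power_field a f).
Proof.
rewrite /power_sum /power_field !mulr_suml !raddf_sum /= mulr_sumr -big_split /=.
apply: eq_bigr => i _; rewrite exprS -mulrA gauss_mulX mderivM mderiv_powX eqxx mulr1.
by rewrite raddfD /= -scalerAl gaussZ.
Qed.

(** Up to sign, the square of the Vandermonde product. *)
Definition vandermonde2 : {mpoly rat[N]} :=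
  \prod_(ij : 'I_N * 'I_N | ij.1 != ij.2) ('X_(ij.1) - 'X_(ij.2)).

(** The field maps X_i - X_j to X_i^a - X_j^a, a multiple of it.  The quotients
    add up to products of two power sums, except that the pairs i = j, absent from
    the Vandermonde product, have to be taken out. *)
Lemma power_field_vandermonde2 a :
  power_field a vandermonde2 =
    vandermonde2 * (\sum_(k < a) power_sum k * power_sum (a - k.+1)
                    - a%:R *: power_sum a.-1).
Proof.
pose h (ij : 'I_N * 'I_N) : {mpoly rat[N]} :=
  \sum_(k < a) 'X_(ij.1) ^+ (a - k.+1) * 'X_(ij.2) ^+ k.
have dX ij : power_field a ('X_(ij.1) - 'X_(ij.2)) = ('X_(ij.1) - 'X_(ij.2)) * h ij.
  have -> : power_field a ('X_(ij.1) - 'X_(ij.2)) =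
      power_field a ('X_(ij.1) ^+ 1) - power_field a ('X_(ij.2) ^+ 1).
    by rewrite /power_field -sumrB; apply: eq_bigr => k _; rewrite mderivB mulrBr !expr1.
  rewrite !power_field_pow !scale1r addn1 /= subrXX; congr (_ * _).
  by apply: eq_bigr => k _; congr (_ ^+ _ * _); lia.
have -> : power_field a vandermonde2 =
    vandermonde2 * \sum_(ij : 'I_N * 'I_N | ij.1 != ij.2) h ij.
  rewrite /vandermonde2 power_field_prod mulr_sumr; apply: eq_bigr => ij ne_ij.
  by rewrite dX [in RHS](bigD1 ij) //=; ring.
congr (_ * _).
have hd : \sum_(ij : 'I_N * 'I_N | ij.1 == ij.2) h ij = a%:R *: power_sum a.-1.
  rewrite (eq_bigl (fun ij => xpredT ij.1 && (ij.2 == ij.1))); last by move=> ij; rewrite eq_sym.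
  rewrite -(pair_big_dep xpredT (fun i j => j == i) (fun i j => h (i, j))) /=.
  rewrite scaler_sumr; apply: eq_bigr => i _; rewrite big_pred1_eq /h /=.
  rewrite (eq_bigr (fun _ => 'X_i ^+ a.-1)); last first.
    by move=> k _; rewrite -exprD; congr (_ ^+ _); have := ltn_ord k; lia.
  by rewrite sumr_const card_ord scaler_nat.
have <- : \sum_ij h ij = \sum_(k < a) power_sum k * power_sum (a - k.+1).
  rewrite (eq_bigr (fun ij => h (ij.1, ij.2))); last by case.
  rewrite -(pair_big xpredT xpredT (fun i j => h (i, j))) /=.
  rewrite /h; under eq_bigr do rewrite exchange_big /=.
  rewrite exchange_big /=; apply: eq_bigr => k _.
  by rewrite mulrC big_distrlr.
by rewrite [in RHS](bigID (fun ij => ij.1 == ij.2)) /= hd addrC addrK.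
Qed.

(** The mean of a symmetric function of the eigenvalues in the Gaussian unitary
    ensemble of size N, by the formula for the eigenvalue distribution. *)
Definition trace_mean f : rat := gauss (f * vandermonde2) / gauss vandermonde2.

Lemma trace_mean_is_linear : linear_for *%R trace_mean.
Proof.
by move=> c f g; rewrite /trace_mean mulrDl raddfD /= -scalerAl gaussZ mulrDl mulrA.
Qed.

HB.instance Definition _ :=
  GRing.isLinear.Build rat {mpoly rat[N]} rat *%R trace_mean trace_mean_is_linear.

Lemma trace_meanZ c f : trace_mean (c *: f) = c * trace_mean f.
Proof. exact: linearZ_LR. Qed.

(** The loop equation of the Gaussian unitary ensemble: the derivative of the
    Vandermonde square contributes the products of two power sums, its diagonal
    terms cancelling the derivative of X_i^a. *)
Lemma trace_mean_loop a f :
  trace_mean (power_sum a.+1 * f) =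
    \sum_(k < a) trace_mean (power_sum k * power_sum (a - k.+1) * f)
    + trace_mean (power_field a f).
Proof.
rewrite /trace_mean -mulr_suml -mulrDl; congr (_ / _).
rewrite -mulrA gauss_power_sum power_fieldM power_field_vandermonde2 raddfD /=.
have -> (q : {mpoly rat[N]}) : f * (vandermonde2 * (q - a%:R *: power_sum a.-1)) =
    q * f * vandermonde2 - a%:R *: (power_sum a.-1 * (f * vandermonde2)).
  by rewrite -!mul_mpolyC; ring.
rewrite raddfB /= gaussZ addrC -addrA subrK addrC; congr (_ + _).
by rewrite !mulr_suml raddf_sum.
Qed.

End TraceFunctional.

(** * One-trace means by orthogonal polynomials *)

Section Determinant.
Variable N : nat.

Definition poly_at (i : 'I_N) (g : {poly rat}) : {mpoly rat[N]} :=
  (map_poly (@mpolyC N rat) g).['X_i].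

Lemma poly_atM i g h : poly_at i (g * h) = poly_at i g * poly_at i h.
Proof. by rewrite /poly_at rmorphM hornerM. Qed.

Lemma poly_atXn i k : poly_at i 'X^k = 'X_i ^+ k.
Proof. by rewrite /poly_at map_polyXn hornerXn. Qed.

Lemma poly_at1 i : poly_at i 1 = 1.
Proof. by rewrite /poly_at rmorph1 hornerE. Qed.

Lemma poly_at_coef i (g : {poly rat}) K : (size g <= K)%N ->
  poly_at i g = \sum_(k < K) g`_k *: 'X_i ^+ k.
Proof.
move=> le_gK; rewrite /poly_at (@horner_coef_wide _ K); last first.
  exact: leq_trans (size_poly _ _) le_gK.
by apply: eq_bigr => k _; rewrite coef_map /= mul_mpolyC.
Qed.

Lemma gauss_prod_poly_at (g : 'I_N -> {poly rat}) :
  gauss (\prod_i poly_at i (g i)) = \prod_i gauss1 (g i).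
Proof.
pose K := \max_i size (g i).
have le_gK i : (size (g i) <= K)%N by exact: leq_bigmax.
rewrite (eq_bigr _ (fun i _ => poly_at_coef i (le_gK i))).
rewrite [RHS](eq_bigr _ (fun i _ => gauss1E (le_gK i))).
rewrite !bigA_distr_bigA raddf_sum; apply: eq_bigr => f _ /=.
rewrite scaler_prod gaussZ big_split /=; congr (_ * _).
transitivity (gauss 'X_[[multinom (f i : nat) | i < N]] : rat); last first.
  by rewrite gaussX; apply: eq_bigr => i _; rewrite mnmE.
by rewrite mpolyXE_id; congr gauss; apply: eq_bigr => i _; rewrite mnmE.
Qed.

Definition hermite_mx : 'M[{mpoly rat[N]}]_N := \matrix_(i, k) poly_at i (hermite k).

(** Monic polynomials of degrees 0, 1, ... differ from the powers by a unitriangular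
    matrix, so they have the same determinant. *)
Lemma det_hermite_mx :
  \det hermite_mx = \prod_(i < N) \prod_(j < N | (i < j)%N) ('X_j - 'X_i).
Proof.
pose P : 'M[{mpoly rat[N]}]_N := \matrix_(k, l) ((hermite k)`_l)%:MP.
pose x : 'rV[{mpoly rat[N]}]_N := \row_i 'X_i.
have -> : hermite_mx = (P *m Vandermonde N x)^T.
  apply/matrixP => i k; rewrite !mxE (@poly_at_coef i _ N) ?(monic_hermite k).2 //.
  by apply: eq_bigr => l _; rewrite !mxE mul_mpolyC.
rewrite det_tr det_mulmx det_Vandermonde det_trig; last first.
  apply/is_trig_mxP => k l lt_kl; rewrite mxE nth_default ?mpolyC0 //.
  by rewrite (monic_hermite k).2.
rewrite big1 ?mul1r => [|k _]; last first.
  have [/eqP mon sz] := monic_hermite k.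
  by rewrite mxE -mpolyC1; congr (_%:MP); rewrite -mon lead_coefE sz.
by apply: eq_bigr => i _; apply: eq_bigr => j _; rewrite !mxE.
Qed.

Lemma vandermonde2_det : exists2 c : rat, c != 0 & vandermonde2 N = c *: (\det hermite_mx) ^+ 2.
Proof.
pose sgn := \prod_(ij : 'I_N * 'I_N | (ij.1 < ij.2)%N) (-1 : rat).
exists sgn; first by apply/prodf_neq0 => ij _; rewrite oppr_eq0 oner_eq0.
rewrite det_hermite_mx pair_big_dep /= -prodrXl -scaler_prod /vandermonde2.
rewrite (bigID (fun ij : 'I_N * 'I_N => (ij.1 < ij.2)%N)) /=.
rewrite [X in _ * X](reindex_inj (h := fun ij : 'I_N * 'I_N => (ij.2, ij.1))) /=; last first.
  by move=> [a b] [c d] [-> ->].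
rewrite [X in _ * X](eq_bigl (fun ij : 'I_N * 'I_N => (ij.1 < ij.2)%N)); last first.
  by move=> [i j] /=; rewrite -leqNgt ltn_neqAle eq_sym.
rewrite (eq_bigl (fun ij : 'I_N * 'I_N => (ij.1 < ij.2)%N)); last first.
  by move=> [i j] /=; rewrite andbC; case: ltngtP => //= ?; rewrite -val_eqE /=; lia.
rewrite -big_split /=; apply: eq_bigr => ij _.
by rewrite scaleN1r; ring.
Qed.

(** Expanding both determinants, orthogonality in the unweighted variables
    leaves only the pairs of equal permutations. *)
Lemma gauss_det2 (i0 : 'I_N) (w : {poly rat}) :
  gauss (poly_at i0 w * (\det hermite_mx) ^+ 2) =
    \sum_(s : 'S_N) gauss1 (w * hermite (s i0) ^+ 2) * \prod_(i | i != i0) (s i)`!%:R.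
Proof.
pose W i : {poly rat} := if i == i0 then w else 1.
have eW : poly_at i0 w = \prod_i poly_at i (W i).
  rewrite (bigD1 i0) //= big1 ?mulr1 /W ?eqxx // => i /negbTE->.
  exact: poly_at1.
rewrite expr2 /determinant big_distrlr /= mulr_sumr raddf_sum /=.
apply: eq_bigr => s _; rewrite mulr_sumr raddf_sum /=.
have term (t : 'S_N) : gauss (poly_at i0 w * ((-1) ^+ s * (\prod_i hermite_mx i (s i)) *
      ((-1) ^+ t * \prod_i hermite_mx i (t i)))) =
    (-1) ^+ s * (-1) ^+ t * \prod_i gauss1 (W i * hermite (s i) * hermite (t i)).
  have eH (u : 'S_N) : \prod_i hermite_mx i (u i) = \prod_i poly_at i (hermite (u i)).
    by apply: eq_bigr => i _; rewrite mxE.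
  have eP : \prod_i poly_at i (W i * hermite (s i) * hermite (t i)) =
      poly_at i0 w * \prod_i hermite_mx i (s i) * \prod_i hermite_mx i (t i).
    rewrite eW !eH -!big_split /=; apply: eq_bigr => i _.
    by rewrite !poly_atM.
  rewrite -gauss_prod_poly_at eP -gaussZ; congr gauss.
  have shuffle (a b x A B : {mpoly rat[N]}) : x * (a * A * (b * B)) = a * b * (x * A * B).
    by ring.
  by rewrite shuffle -mul_mpolyC rmorphM !rmorph_sign.
transitivity (\sum_(t : 'S_N) (-1) ^+ s * (-1) ^+ t *
    \prod_i gauss1 (W i * hermite (s i) * hermite (t i))).
  by apply: eq_bigr => t _; exact: term.
rewrite (bigD1 s) //= [X in _ + X]big1 ?addr0 => [|t ne_ts].
  rewrite -expr2 sqrr_sign mul1r [LHS](bigD1 i0) //= {1}/W eqxx -mulrA -expr2; congr (_ * _).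
  apply: eq_bigr => i /negbTE ne_i.
  by rewrite /W ne_i mul1r hermite_orthogonal eqxx mul1r.
have [j ne_j ne_st] : exists2 j, j != i0 & s j != t j.
  apply/exists_inP; apply: contraR ne_ts; rewrite negb_exists => /forallP eq_off.
  have eq_st j : j != i0 -> s j = t j.
    by move=> ne_j; have := eq_off j; rewrite ne_j negbK => /eqP.
  apply/eqP/permP => j; have [->|/eq_st //] := eqVneq j i0.
  pose k := (s^-1)%g (t i0); have sk : s k = t i0 by rewrite permKV.
  have [ek|/eq_st] := eqVneq k i0; first by rewrite -sk ek.
  by rewrite sk => /perm_inj ek; exact: esym (etrans (congr1 s ek) sk).
rewrite (bigD1 j) //= /W (negbTE ne_j) mul1r hermite_orthogonal.
by rewrite val_eqE (negbTE ne_st) !mul0r mulr0.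
Qed.

Lemma gauss_power_sum_det2 m :
  gauss (power_sum N m * (\det hermite_mx) ^+ 2) =
    N`!%:R * (\prod_(j < N) j`!%:R) * kernel_moment N m.
Proof.
have nz (j : 'I_N) : (j`!%:R : rat) != 0 by rewrite pnatr_eq0 -lt0n fact_gt0.
rewrite /power_sum mulr_suml raddf_sum /=.
under eq_bigr => i _ do rewrite -poly_atXn gauss_det2.
rewrite exchange_big /= -mulrA.
have -> : N`!%:R = \sum_(s : 'S_N) (1 : rat).
  by rewrite sumr_const card_Sn.
rewrite mulr_suml; apply: eq_bigr => s _; rewrite mul1r.
rewrite /kernel_moment /hermite_kernel ['X^m * (\sum_(_ < _) _)]mulr_sumr [gauss1 _ in RHS]raddf_sum mulr_sumr /=.
rewrite [RHS](reindex_inj (@perm_inj _ s)); apply: eq_bigr => i _ /=.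
rewrite [X in _ = X * _](reindex_inj (@perm_inj _ s)) /= [X in _ = X * _](bigD1 i) //=.
by rewrite -scalerAr gauss1Z; field; rewrite nz.
Qed.

End Determinant.

Lemma gauss_vandermonde2_neq0 N : (0 < N)%N -> gauss (vandermonde2 N) != 0.
Proof.
move=> N_gt0; have [c nz_c ->] := vandermonde2_det N; rewrite gaussZ mulf_neq0 //.
have nzN : N%:R != 0 :> rat by rewrite pnatr_eq0 -lt0n.
have := gauss_power_sum_det2 N 0; rewrite power_sum0 kernel_moment0 mulr_natl raddfMn /=.
rewrite -[LHS]mulr_natl [RHS]mulrC => /(mulfI nzN) ->.
rewrite mulf_neq0 ?pnatr_eq0 -?lt0n ?fact_gt0 //; apply/prodf_neq0 => j _.
by rewrite pnatr_eq0 -lt0n fact_gt0.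
Qed.

Lemma trace_mean1 N : (0 < N)%N -> trace_mean (1 : {mpoly rat[N]}) = 1.
Proof. by move=> N_gt0; rewrite /trace_mean mul1r divff ?gauss_vandermonde2_neq0. Qed.

Lemma trace_meanC N c : (0 < N)%N -> trace_mean (c%:MP : {mpoly rat[N]}) = c.
Proof.
by move=> N_gt0; rewrite -[c%:MP]mulr1 mul_mpolyC trace_meanZ trace_mean1 // mulr1.
Qed.

(** Normalising gauss_power_sum_det2 by its case m = 0, where the kernel has mass N. *)
Lemma trace_mean_power_sum N m : (0 < N)%N ->
  trace_mean (power_sum N m) = kernel_moment N m.
Proof.
move=> N_gt0; have nzN : N%:R != 0 :> rat by rewrite pnatr_eq0 -lt0n.
have := gauss_vandermonde2_neq0 N_gt0; rewrite /trace_mean.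
have [c nz_c ->] := vandermonde2_det N; rewrite -scalerAr !gaussZ => nz.
rewrite gauss_power_sum_det2.
have h0 := gauss_power_sum_det2 N 0; rewrite power_sum0 kernel_moment0 mulr_natl raddfMn /= in h0.
rewrite -[LHS]mulr_natl [RHS]mulrC in h0; have {}h0 := mulfI nzN h0.
rewrite -h0; move: nz; set d := gauss _; rewrite mulf_eq0 negb_or => /andP[_ nz].
by field; rewrite nz_c nz.
Qed.

(** * Cycles of a permutation multiplied by a transposition *)

Section Transposition.
Variable T : finType.
Implicit Types (s : {perm T}) (e f x z : T) (A C F : {set T}).

Lemma porbit_sub s C x : {in C, forall z, s z \in C} -> x \in C -> porbit s x \subset C.
Proof.
move=> stabC Cx; apply/subsetP => _ /porbitP[i ->].
by elim: i => [|i IHi]; rewrite ?perm1 // expgSr permM stabC.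
Qed.

Lemma mem_porbit_perm s x z : (s z \in porbit s x) = (z \in porbit s x).
Proof. by rewrite -!eq_porbit_mem -[s z]/((s ^+ 1)%g z) porbit_perm. Qed.

Lemma porbit_memE s x z : z \in porbit s x -> porbit s z = porbit s x.
Proof. by rewrite -eq_porbit_mem => /eqP. Qed.

Lemma porbitsP s C x : C \in porbits s -> x \in C -> C = porbit s x.
Proof. by case/imsetP => y _ -> /porbit_memE. Qed.

(** Multiplying by the same transposition twice changes nothing, so of the two
    multiplications one merges two cycles and the other splits one. *)
Lemma mem_porbit_tperm s e f : e != f ->
  (e \in porbit (tperm e f * s)%g f) = (e \notin porbit s f).
Proof.
move=> ne_ef; have := porbits_mul_tperm s e f; have := porbits_mul_tperm (tperm e f * s)%g e f.
by rewrite /= tpermKg ne_ef; case: (e \in _); case: (e \in _) => //=; lia.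
Qed.

Lemma porbit_tperm_off s e f z : e \notin porbit s z -> f \notin porbit s z ->
  porbit (tperm e f * s)%g z = porbit s z.
Proof.
move=> ne nf.
have exp_id n : ((tperm e f * s) ^+ n)%g z = (s ^+ n)%g z.
  elim: n => // n IHn; rewrite !expgSr !permM {}IHn tpermD //.
    by apply: contraNneq ne => ->; apply: mem_porbit.
  by apply: contraNneq nf => ->; apply: mem_porbit.
apply/porbit_setP => u; apply/idP/idP => /porbitP[i ->]; first by rewrite exp_id mem_porbit.
by rewrite -exp_id mem_porbit.
Qed.

Lemma mem_porbits_tperm s e f C : e \notin C -> f \notin C ->
  (C \in porbits (tperm e f * s)%g) = (C \in porbits s).
Proof.
move=> ne nf; have sub u : C \in porbits u -> C \in porbits (tperm e f * u)%g.
  move=> /imsetP[z _ eC]; rewrite {1}eC -(@porbit_tperm_off u e f z) -?eC //.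
  exact: imset_f.
by apply/idP/idP => /sub //; rewrite tpermKg.
Qed.

Lemma porbit_merge s e f : f \notin porbit s e ->
  porbit (tperm e f * s)%g e = porbit s e :|: porbit s f.
Proof.
move=> nf; have ne_ef : e != f by apply: contraNneq nf => <-; exact: porbit_id.
apply/eqP; rewrite eqEsubset; apply/andP; split.
  apply: porbit_sub => [z|]; last by rewrite inE porbit_id.
  rewrite !inE permM !mem_porbit_perm; case: tpermP => [_ _|_ _|//].
    by rewrite porbit_id orbT.
  by rewrite porbit_id.
set C := porbit (tperm e f * s)%g e; have Ce : e \in C by exact: porbit_id.
have Cf : f \in C by rewrite /C porbit_sym mem_porbit_tperm // porbit_sym.
have stabC z : z \in C -> s z \in C.
  move=> Cz; have -> : s z = (tperm e f * s)%g (tperm e f z) by rewrite permM tpermK.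
  by rewrite /C mem_porbit_perm -/C; case: tpermP.
by rewrite subUset !porbit_sub.
Qed.

(** The inverse of a merge. *)
Lemma porbit_split s e f : f \in porbit s e -> e != f ->
  porbit s e = porbit (tperm e f * s)%g e :|: porbit (tperm e f * s)%g f.
Proof.
move=> ef ne_ef; rewrite -porbit_merge ?tpermKg //.
by rewrite porbit_sym mem_porbit_tperm // porbit_sym negbK.
Qed.

Lemma porbit_split_disjoint s e f : f \in porbit s e -> e != f ->
  e \notin porbit (tperm e f * s)%g f.
Proof. by move=> ef ne_ef; rewrite mem_porbit_tperm // porbit_sym negbK. Qed.

Lemma setI_setD2_id (O A : {set T}) e f : e \notin O -> f \notin O ->
  O :&: (A :\ e :\ f) = O :&: A.
Proof.
move=> ne nf; apply/setP => z; rewrite !inE; have [Oz|//] := boolP (z \in O).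
by rewrite (contraTneq _ Oz) ?(contraTneq _ Oz) // => ->.
Qed.

Section Products.
Variables (R : comNzRingType) (phi : {set T} -> R).

Lemma prod_porbits_split s e f F : f \in porbit s e -> e != f -> porbit s e \subset F ->
  \prod_(O in porbits (tperm e f * s)%g | O \subset F) phi O =
    phi (porbit (tperm e f * s)%g e) * phi (porbit (tperm e f * s)%g f) *
    \prod_(O in porbits s | (O \subset F) && (e \notin O)) phi O.
Proof.
move=> ef ne_ef; set s' := (tperm e f * s)%g; rewrite (porbit_split ef ne_ef) -/s' subUset.
case/andP=> sub_e sub_f; have nef := porbit_split_disjoint ef ne_ef; rewrite -/s' in nef.
rewrite (bigD1 (porbit s' e)) /=; last by rewrite imset_f.
rewrite (bigD1 (porbit s' f)) /=; last first.
  by rewrite imset_f // sub_f eq_sym eq_porbit_mem.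
rewrite mulrA; congr (_ * _); apply: eq_bigl => O.
apply/idP/idP => [/andP[/andP[/andP[OO sub_O] ne_O] nf_O]|/and3P[OO sub_O nO]].
  have nO : e \notin O by apply: contraNN ne_O => Oe; rewrite (porbitsP OO Oe).
  have nO' : f \notin O by apply: contraNN nf_O => Of; rewrite (porbitsP OO Of).
  by rewrite -(mem_porbits_tperm s nO nO') OO sub_O nO.
have nO' : f \notin O.
  apply: contraNN nO => Of; rewrite (porbitsP OO Of).
  by rewrite porbit_sym.
rewrite (mem_porbits_tperm s nO nO') OO sub_O /=.
by rewrite (contraNneq _ nO) ?(contraNneq _ nO') // => ->; exact: porbit_id.
Qed.

Lemma prod_porbits_merge s e f F : f \notin porbit s e ->
  porbit s e \subset F -> porbit s f \subset F ->
  \prod_(O in porbits (tperm e f * s)%g | O \subset F) phi O =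
    phi (porbit s e :|: porbit s f) *
    \prod_(O in porbits s | [&& O \subset F, e \notin O & f \notin O]) phi O.
Proof.
move=> nef sub_e sub_f; set s' := (tperm e f * s)%g; rewrite -(porbit_merge nef) -/s'.
rewrite (bigD1 (porbit s' e)) /=; last by rewrite imset_f //= porbit_merge // subUset sub_e.
congr (_ * _); apply: eq_bigl => O.
apply/idP/idP => [/andP[/andP[OO sub_O] ne_O]|/and4P[OO sub_O nO nO']].
  have nO : e \notin O by apply: contraNN ne_O => Oe; rewrite (porbitsP OO Oe).
  have nO' : f \notin O.
    apply: contraNN nO => Of; rewrite (porbitsP OO Of) porbit_sym.
    by rewrite porbit_merge // inE porbit_id orbT.
  by rewrite -(mem_porbits_tperm s nO nO') OO sub_O nO.
rewrite (mem_porbits_tperm s nO nO') OO sub_O /=.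
by apply: contraNneq nO => ->; exact: porbit_id.
Qed.

End Products.

Definition arc s e d : {set T} := [set x in traject s (s e) d].

(** On the arc from e to f, only the last point f has a new successor, which is the
    first point of the arc. *)
Lemma porbit_split_arc s e d : (0 < d < #|porbit s e|)%N ->
  porbit (tperm e (iter d s e) * s)%g (iter d s e) = arc s e d.
Proof.
case/andP; case: d => // d _ lt_dl; set f := iter d.+1 s e; set s' := (tperm e f * s)%g.
have inj i j : (i < #|porbit s e|)%N -> (j < #|porbit s e|)%N ->
    iter i s e = iter j s e -> i = j.
  move=> lt_i lt_j eq_ij; apply/eqP.
  rewrite -(nth_uniq e _ _ (uniq_traject_porbit s e)) ?size_traject //.
  by rewrite !nth_traject // eq_ij.
have s'E i : (i < d)%N -> s' (iter i.+1 s e) = iter i.+2 s e.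
  move=> lt_id; rewrite permM tpermD //.
    by apply/eqP => /(@inj 0 i.+1); rewrite (leq_ltn_trans _ lt_dl) //; lia.
  by apply/eqP => /(@inj d.+1 i.+1); lia.
have s'f : s' f = s e by rewrite permM tpermR.
apply/eqP; rewrite eqEsubset; apply/andP; split.
  apply: porbit_sub => [x|]; last first.
    by rewrite in_set; apply/trajectP; exists d; rewrite // -iterSr.
  rewrite !in_set => /trajectP[i lt_id ->]; rewrite -iterSr; apply/trajectP.
  have [eq_id|ne_id] := eqVneq i d; first by exists 0%N; rewrite // eq_id s'f.
  by exists i.+1; [lia | rewrite s'E -?iterSr //; lia].
apply/subsetP => x; rewrite in_set => /trajectP[i lt_id ->{x}].
elim: i lt_id => [_|i IHi lt_id]; first by rewrite /= -s'f mem_porbit_perm porbit_id.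
by rewrite -iterSr -s'E // mem_porbit_perm iterSr IHi //; lia.
Qed.

(** As f runs through the points of A on the cycle of e, the number of points of
    A strictly between e and f takes each possible value once. *)
Lemma sum_split_arcs (R : nmodType) (g : nat -> nat -> R) s e A :
  e \in A -> let X := (porbit s e :&: A) :\ e in
  \sum_(f in X) g #|porbit (tperm e f * s)%g f :&: (A :\ e :\ f)|
                  #|porbit (tperm e f * s)%g e :&: (A :\ e :\ f)| =
    \sum_(k < #|X|) g k (#|X| - k.+1)%N.
Proof.
(* h f counts the points of A strictly between e and f. *)
move=> Ae X; pose h f := #|porbit (tperm e f * s)%g f :&: (A :\ e :\ f)|.
have XP f : f \in X -> [/\ f != e, f \in porbit s e & f \in A].
  by rewrite !inE => /and3P[].
have hD f : f \in X ->
    (h f + #|porbit (tperm e f * s)%g e :&: (A :\ e :\ f)|).+1 = #|X|.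
  move=> /[dup] Xf /XP[ne_fe ef Af]; rewrite -cardsUI -setIUl -setIIl.
  rewrite [porbit _ f :&: porbit _ e](_ : _ = set0); last first.
    apply/setP => z; rewrite !inE; apply/negP => /andP[zf ze].
    have ne_ef : e != f by rewrite eq_sym.
    have /negP[] := porbit_split_disjoint ef ne_ef.
    by rewrite -(porbit_memE zf) porbit_sym.
  rewrite set0I cards0 addn0 setUC -porbit_split //; last by rewrite eq_sym.
  rewrite (cardsD1 f X) Xf add1n; congr _.+1; apply: eq_card => z.
  by rewrite !inE; case: (z == f); case: (z == e); rewrite ?andbF.
have h_lt f : f \in X -> (h f < #|X|)%N by move=> /hD <-; lia.
have h_inj : {in X &, injective h}.
  have harc f : f \in X -> exists2 d, (0 < d < #|porbit s e|)%N &
      f = iter d s e /\ (h f).+1 = #|arc s e d :&: A|.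
    move=> /[dup] Xf /XP[ne_fe]; rewrite porbit_traject => /trajectP[d lt_d ef] Af.
    have d_gt0 : (0 < d)%N by case: d ef ne_fe {lt_d} => // ->; rewrite eqxx.
    exists d; rewrite ?d_gt0 //; split=> //; rewrite /h.
    have ef' : f \in porbit s e by rewrite ef -permX mem_porbit.
    have eP : porbit (tperm e f * s)%g f = arc s e d.
      by rewrite ef porbit_split_arc ?d_gt0.
    have := porbit_split_disjoint ef'; rewrite eq_sym => /(_ ne_fe) eC.
    have fC := porbit_id (tperm e f * s)%g f; rewrite eP in eC fC *.
    rewrite (cardsD1 f (arc _ _ _ :&: A)) in_setI fC Af add1n; congr _.+1; apply: eq_card => z.
    rewrite !(in_setI, in_setD1); have [->|_] := eqVneq z e.
      by rewrite (negbTE eC) /= !andbF.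
    by rewrite andbCA.
  suff mono d d' : (d < d' < #|porbit s e|)%N -> iter d' s e \in A ->
      (#|arc s e d :&: A| < #|arc s e d' :&: A|)%N.
    move=> f f' Xf Xf' eq_h.
    have [d /andP[_ lt_d] [ef hf]] := harc f Xf.
    have [d' /andP[_ lt_d'] [ef' hf']] := harc f' Xf'.
    have [_ _ Af] := XP _ Xf; have [_ _ Af'] := XP _ Xf'.
    rewrite ef ef' in Af Af'.
    case: (ltngtP d d') => [lt|lt|eq]; last by rewrite ef ef' eq.
      by have := mono d d'; rewrite lt lt_d' -hf -hf' eq_h ltnn => /(_ isT Af').
    by have := mono d' d; rewrite lt lt_d -hf -hf' eq_h ltnn => /(_ isT Af).
  case/andP=> lt_dd' lt_d' Ad'; apply: proper_card; apply/properP; split.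
    apply: setSI; apply/subsetP => z; rewrite !inE => /trajectP[i lt_i ->].
    by apply/trajectP; exists i => //; lia.
  exists (iter d' s e); rewrite !inE Ad' andbT.
    by apply/trajectP; exists d'.-1; rewrite -?iterSr ?prednK //; lia.
  apply/negP => /trajectP[i lt_i]; rewrite -iterSr => eq_i.
  have := nth_uniq e _ _ (uniq_traject_porbit s e); rewrite size_traject.
  move=> /(_ d' i.+1 lt_d'); rewrite !nth_traject //; try lia.
  by rewrite eq_i eqxx => /(_ _)/esym/eqP; lia.
transitivity (\sum_(f in X) g (h f) (#|X| - (h f).+1)%N).
  apply: eq_bigr => f Xf; rewrite -/(h f); congr (g _ _).
  by have := hD f Xf; lia.
rewrite -(big_mkord xpredT (fun k => g k (#|X| - k.+1)%N)) -big_enum /=.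
rewrite -(big_map h xpredT (fun k => g k (#|X| - k.+1)%N)).
have uniq_h : uniq (map h (enum X)).
  by rewrite map_inj_in_uniq ?enum_uniq // => x y; rewrite !mem_enum; exact: h_inj.
apply/perm_big/uniq_perm; rewrite ?iota_uniq //.
have sub_h : {subset map h (enum X) <= index_iota 0 #|X|}.
  by move=> k /mapP[x]; rewrite mem_enum mem_index_iota => /h_lt lt_h ->.
have [|_ eq_h] := uniq_min_size uniq_h sub_h; last exact: eq_h.
by rewrite size_iota size_map -cardE subn0.
Qed.

End Transposition.

(** * Pairings counted by cycles *)

Section Pairings.
Variables (T I : finType) (lab : T -> I) (N : nat).
Hypothesis N_gt0 : (0 < N)%N.
Implicit Types (s : {perm T}) (e f x z : T) (A C F : {set T}).

(** The edges outside A are already glued; they stay as fixed points. *)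
Definition pairings A : {set {perm T}} :=
  [set iota : {perm T} | [forall x, [&& iota (iota x) == x,
     (iota x == x) == (x \notin A) & lab (iota x) == lab x]]].

Lemma pairingsP A (iota : {perm T}) :
  reflect [/\ forall x, iota (iota x) = x, forall x, (iota x == x) = (x \notin A)
             & forall x, lab (iota x) = lab x]
          (iota \in pairings A).
Proof.
rewrite inE; apply: (iffP forallP) => [h|[h1 h2 h3] x].
  by split=> x; have /and3P[/eqP h1 /eqP h2 /eqP h3] := h x.
by rewrite h1 h2 h3 !eqxx.
Qed.

Definition pairing_sum A s : rat :=
  \sum_(iota in pairings A) N%:R ^+ #|porbits (iota * s)%g|.

(** The cycles inside F are polygons whose remaining edges are those in A. *)
Definition orbit_trace s A F : {mpoly rat[N]} :=
  \prod_(O in porbits s | O \subset F) power_sum N #|O :&: A|.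

(** Multiplying by the transposition of e and f adds or removes this pair. *)
Lemma mem_pairings_tperm A e f (iota : {perm T}) :
    e \in A -> f \in A -> e != f -> lab f = lab e ->
  ((tperm e f * iota)%g \in pairings A) && ((tperm e f * iota)%g e == f) =
    (iota \in pairings (A :\ e :\ f)).
Proof.
move=> Ae Af ne_ef lab_ef; set t := tperm e f.
apply/andP/idP => [[/pairingsP[h1 h2 h3] /eqP h4]|/pairingsP[h1 h2 h3]].
  have te : iota f = f by move: h4; rewrite permM tpermL.
  have tf : iota e = e by have := h1 e; rewrite h4 permM tpermR.
  have off x : x != e -> x != f -> iota x = (t * iota)%g x.
    by move=> xe xf; rewrite permM tpermD // eq_sym.
  apply/pairingsP; split=> x; have [->|xe] := eqVneq x e; rewrite ?tf ?tf //;
    try (by rewrite ?eqxx ?in_setD1 ?eqxx ?andbF //);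
    have [->|xf] := eqVneq x f; rewrite ?te //;
    try (by rewrite ?eqxx ?in_setD1 ?eqxx ?andbF //).
  - have iox : iota x != e by rewrite -{1}tf (inj_eq perm_inj).
    have iox' : iota x != f by rewrite -{1}te (inj_eq perm_inj).
    by rewrite (off _ iox iox') (off _ xe xf) h1.
  - by rewrite !in_setD1 xe xf /= (off _ xe xf) h2.
  by rewrite (off _ xe xf) h3.
have te : iota e = e by apply/eqP; rewrite h2 !in_setD1 eqxx andbF.
have tf : iota f = f by apply/eqP; rewrite h2 !in_setD1 eqxx.
have off x : x != e -> x != f -> (t * iota)%g x = iota x.
  by move=> xe xf; rewrite permM tpermD // eq_sym.
have te' : (t * iota)%g e = f by rewrite permM tpermL.
have tf' : (t * iota)%g f = e by rewrite permM tpermR.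
split; last by rewrite te'.
apply/pairingsP; split=> x.
- have [->|xe] := eqVneq x e; first by rewrite te'.
  have [->|xf] := eqVneq x f; first by rewrite tf'.
  have iox : iota x != e by rewrite -{1}te (inj_eq perm_inj).
  have iox' : iota x != f by rewrite -{1}tf (inj_eq perm_inj).
  by rewrite (off _ xe xf) off.
- have [->|xe] := eqVneq x e; first by rewrite te' Ae eq_sym (negbTE ne_ef).
  have [->|xf] := eqVneq x f; first by rewrite tf' Af (negbTE ne_ef).
  by rewrite (off _ xe xf) h2 !in_setD1 xe xf.
have [->|xe] := eqVneq x e; first by rewrite te'.
have [->|xf] := eqVneq x f; first by rewrite tf'.
by rewrite (off _ xe xf).
Qed.

(** The recurrence obtained by removing the pair that contains e. *)
Lemma pairing_sum_rec A s e : e \in A ->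
  pairing_sum A s =
    \sum_(f in A | (f != e) && (lab f == lab e)) pairing_sum (A :\ e :\ f) (tperm e f * s)%g.
Proof.
move=> Ae; rewrite /pairing_sum.
rewrite (partition_big (fun iota : {perm T} => iota e)
   (fun f => (f \in A) && ((f != e) && (lab f == lab e)))) /=; last first.
  move=> iota /pairingsP[h1 h2 h3]; rewrite h3 eqxx andbT h2 Ae andbT.
  by have := h2 (iota e); rewrite h1 eq_sym h2 Ae /= => /esym/negbFE.
apply: eq_bigr => f /and3P[Af ne_fe /eqP lab_ef].
rewrite (reindex_inj (mulgI (tperm e f))) /=; apply: eq_big => iota.
  by rewrite mem_pairings_tperm // eq_sym.
rewrite mem_pairings_tperm // 1?eq_sym // => /pairingsP[h1 h2 h3].
have te : iota e = e by apply/eqP; rewrite h2 !in_setD1 eqxx andbF.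
have tf : iota f = f by apply/eqP; rewrite h2 !in_setD1 eqxx.
congr (_ ^+ #|porbits _|); rewrite mulgA; congr (_ * _)%g.
apply/permP => x; rewrite !permM; case: tpermP => [->|->|/eqP xe /eqP xf].
- by rewrite te tpermL tf.
- by rewrite tf tpermR te.
have iox : iota x != e by rewrite -{1}te (inj_eq perm_inj).
have iox' : iota x != f by rewrite -{1}tf (inj_eq perm_inj).
by rewrite tpermD // eq_sym.
Qed.

Lemma orbit_trace_off s A F e f : e \notin F -> f \notin F ->
  orbit_trace (tperm e f * s)%g (A :\ e :\ f) F = orbit_trace s A F.
Proof.
move=> nFe nFf; apply: eq_big => O.
  have [sub_O|_] := boolP (O \subset F); last by rewrite !andbF.
  by rewrite mem_porbits_tperm // (contraNN (subsetP sub_O _)).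
case/andP=> _ sub_O; congr (power_sum _ _).
by rewrite setI_setD2_id // (contraNN (subsetP sub_O _)).
Qed.

(** The loop equation, read on cycles: the two ways of choosing f are the two
    kinds of terms, f on the cycle of e (which splits) or elsewhere (merging). *)
Lemma trace_mean_orbits s A F e : {in F, forall x, s x \in F} -> e \in A -> e \in F ->
  trace_mean (orbit_trace s A F) =
    \sum_(f in A | (f != e) && (f \in F))
      trace_mean (orbit_trace (tperm e f * s)%g (A :\ e :\ f) F).
Proof.
move=> stabF Ae Fe; set Oe := porbit s e; pose X := (Oe :&: A) :\ e.
have sub_orb x : x \in F -> porbit s x \subset F by apply: porbit_sub.
have cardX : #|Oe :&: A| = #|X|.+1 by rewrite (cardsD1 e) inE porbit_id Ae.
pose Q (O : {set T}) := [&& O \in porbits s, O \subset F & e \notin O].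
pose G : {mpoly rat[N]} := \prod_(O | Q O) power_sum N #|O :&: A|.
have dG a : power_field a G = \sum_(O | Q O) #|O :&: A|%:R *: (power_sum N (a + #|O :&: A|).-1 *
     \prod_(O' | Q O' && (O' != O)) power_sum N #|O' :&: A|).
  rewrite power_field_prod; apply: eq_bigr => O _.
  by rewrite power_field_power_sum scalerAl.
have -> : orbit_trace s A F = power_sum N #|X|.+1 * G.
  rewrite /orbit_trace (bigD1 Oe) /=; last by rewrite imset_f //= sub_orb.
  rewrite cardX; congr (_ * _); apply: eq_bigl => O; rewrite /Q -andbA.
  have [OO|//] := boolP (O \in porbits s); rewrite /=; congr (_ && _).
  apply/idP/idP; first by apply: contraNN => /(porbitsP OO) ->.
  by apply: contraNneq => ->; exact: porbit_id.
(* The terms of the derivative of G are indexed by the cycles other than that of e. *)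
rewrite trace_mean_loop dG raddf_sum /=.
rewrite (bigID (fun f => f \in Oe)) /=; congr (_ + _).
  rewrite -(sum_split_arcs (fun k l => trace_mean (power_sum N k * power_sum N l * G)) s Ae).
  apply: eq_big => f; first by rewrite !inE -/Oe; case: (boolP (f \in Oe)) => // fO;
    rewrite ?andbF // (subsetP (sub_orb e Fe)) // !andbT andbC.
  rewrite !inE => /and3P[ne_fe fO Af]; congr trace_mean.
  have ne_ef : e != f by rewrite eq_sym.
  rewrite /orbit_trace (prod_porbits_split _ fO ne_ef) ?sub_orb //.
  rewrite [power_sum N _ * power_sum N _]mulrC; congr (_ * _).
  apply: eq_big => O; first by [].
  move=> /and3P[OO sub_O nO]; rewrite setI_setD2_id //.
  by apply: contraNN nO => /(porbitsP OO) ->; rewrite porbit_sym.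
rewrite (partition_big (porbit s) Q) /=; last first.
  move=> f /andP[/and3P[Af ne_fe Ff] fO].
  by rewrite /Q imset_f // sub_orb // porbit_sym.
apply: eq_bigr => O /and3P[OO sub_O nO].
rewrite trace_meanZ mulr_natl -sumr_const; apply: eq_big => f.
  apply/idP/idP.
    rewrite inE => /andP[Of Af]; rewrite Af (subsetP sub_O) // eq_sym (porbitsP OO Of) eqxx /= andbT.
    rewrite (contraNneq _ nO) /=; last by move=> ->.
    by rewrite porbit_sym -(porbitsP OO Of).
  by case/andP=> /andP[/and3P[Af _ _] _] /eqP eO; rewrite inE Af -eO porbit_id.
rewrite inE => /andP[Of Af]; congr trace_mean.
have eO := porbitsP OO Of; have nf : f \notin porbit s e by rewrite porbit_sym -eO.
have ne_ef : e != f by apply: contraNneq nf => <-; exact: porbit_id.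
rewrite /orbit_trace (prod_porbits_merge _ nf) ?sub_orb //; last exact: subsetP Of.
congr (power_sum _ _ * _).
  rewrite -eO; pose U := (Oe :|: O) :&: A.
  have -> : (Oe :|: O) :&: (A :\ e :\ f) = U :\ e :\ f.
    by apply/setP => z; rewrite !inE; case: (z == e); case: (z == f); rewrite ?andbF.
  have cardU : #|U| = (#|X|.+1 + #|O :&: A|)%N.
    have disj : (Oe :&: A) :&: (O :&: A) = set0.
      apply/setP => z; rewrite !inE; apply/negP => /andP[/andP[ze _] /andP[zO _]].
      by case/negP: nO; rewrite (porbitsP OO zO) porbit_sym.
    by rewrite /U setIUl cardsU disj cards0 subn0 cardX.
  have := cardsD1 e U; have := cardsD1 f (U :\ e).
  rewrite !inE porbit_id Ae Af Of orbT eq_sym ne_ef cardU /= => -> ; lia.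
have eQ O' : Q O' && (O' != O) = [&& O' \in porbits s, O' \subset F, e \notin O' & f \notin O'].
  rewrite /Q -!andbA; have [OO'|//] := boolP (O' \in porbits s); rewrite /=.
  congr [&& _, _ & _]; apply/idP/idP; last by apply: contraNneq => ->.
  by apply: contraNN => /(porbitsP OO') ->; rewrite -eO.
apply: eq_big => O'; first exact: eQ.
by rewrite eQ => /and4P[OO' sub_O' nO1 nO2]; rewrite setI_setD2_id.
Qed.

(** Once all edges are glued, the cycles of s are the vertices, each counting N. *)
Lemma pairing_sum0 s : (forall x, lab (s x) = lab x) ->
  pairing_sum set0 s = \prod_(i : I) trace_mean (orbit_trace s set0 [set x | lab x == i]).
Proof.
move=> lab_s; rewrite /pairing_sum (big_pred1 1%g) => [|iota]; last first.
  apply/pairingsP/eqP => [[_ h2 _]|->]; last by split=> x; rewrite !perm1 // inE eqxx.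
  by apply/permP => x; rewrite perm1; apply/eqP; rewrite h2 inE.
rewrite mul1g -prodr_const.
transitivity (\prod_(i : I) \prod_(O in porbits s | O \subset [set x | lab x == i]) (N%:R : rat)).
  rewrite (exchange_big_dep (mem (porbits s))) /=; last by move=> i O _ /andP[].
  apply: eq_bigr => O /imsetP[x _ ->]; rewrite (big_pred1 (lab x)) // => i.
  rewrite imset_f //=; apply/idP/eqP => [/subsetP/(_ x (porbit_id s x))|->].
    by rewrite inE => /eqP.
  by apply: porbit_sub => [z|]; rewrite !inE // lab_s.
apply: eq_bigr => i _; rewrite /orbit_trace.
rewrite [in RHS](eq_bigr (fun _ => N%:R%:MP)) => [|O _]; last first.
  by rewrite setI0 cards0 power_sum0 rmorph_nat.
by rewrite -[X in trace_mean X]rmorph_prod trace_meanC.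
Qed.

(** Both sides satisfy the recurrence given by the choice of the edge f paired with
    a fixed e in A.  The labels split the surface into independent parts, of which
    the choice concerns only the one that contains e. *)
Theorem pairing_sumE A s : (forall x, lab (s x) = lab x) ->
  pairing_sum A s = \prod_(i : I) trace_mean (orbit_trace s A [set x | lab x == i]).
Proof.
have [n] := ubnP #|A|; elim: n A s => // n IHn A s le_An lab_s.
have [->|[e Ae]] := set_0Vmem A; first exact: pairing_sum0.
rewrite (pairing_sum_rec _ Ae) (bigD1 (lab e)) //=.
rewrite (trace_mean_orbits _ Ae); last 2 first.
- by move=> x; rewrite !inE lab_s.
- by rewrite inE.
rewrite mulr_suml; apply: eq_big => f; first by rewrite !inE.
case/and3P=> Af ne_fe lab_ef; rewrite IHn.
- rewrite (bigD1 (lab e)) //=; congr (_ * _); apply: eq_bigr => i ne_i.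
  by rewrite orbit_trace_off // inE ?(eqP lab_ef) eq_sym.
- rewrite -ltnS (leq_trans _ le_An) // ltnS [X in (_ < X)%N](cardsD1 e) Ae add1n ltnS.
  by rewrite subset_leq_card // subD1set.
by move=> x; rewrite permM lab_s; case: tpermP => // ->; rewrite (eqP lab_ef).
Qed.

End Pairings.

(** * Truncated power series *)

Definition convolution (f g : nat -> rat) (n : nat) : rat :=
  \sum_(i < n.+1) f i * g (n - i)%N.

(** Multiplication of the generating function by x^b. *)
Definition shift (b : nat) (f : nat -> rat) (n : nat) : rat :=
  if (n < b)%N then 0 else f (n - b)%N.

Section TruncatedSeries.
Variable M : nat.

Definition truncation : comNzRingType := {poly %/ ('X^(M.+1) : {poly rat})}.

Definition truncate : {rmorphism {poly rat} -> truncation} := in_qpoly 'X^(M.+1).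

(** Power series are replaced by their classes modulo x^(M+1), a commutative ring in
    which identities between generating functions can be computed. *)
Lemma truncate_eqP (p q : {poly rat}) :
  (forall i, (i <= M)%N -> p`_i = q`_i) <-> truncate p = truncate q.
Proof.
have modE (u : {poly rat}) i : (in_qpoly 'X^(M.+1) u : {poly rat})`_i = if (i <= M)%N then u`_i else 0.
  by rewrite /= mk_monic_Xn -Pdiv.RingMonic.take_poly_rmodp coef_take_poly.
split=> [eq_pq|/(congr1 (fun u : {poly %/ ('X^(M.+1) : {poly rat})} => (u : {poly rat}))) eq_pq i le_iM].
  by apply/val_inj/polyP => i; rewrite /= !modE; case: leqP => // /eq_pq.
by have := congr1 (fun u : {poly rat} => u`_i) eq_pq; rewrite /= !modE le_iM.
Qed.

Definition series (f : nat -> rat) : truncation := truncate (\poly_(i < M.+1) f i).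

Lemma truncate_series (p : {poly rat}) (f : nat -> rat) :
  (forall i, (i <= M)%N -> p`_i = f i) -> truncate p = series f.
Proof. by move=> pf; apply/truncate_eqP => i le_iM; rewrite coef_poly ltnS le_iM pf. Qed.

Lemma series_inj f g : series f = series g -> forall i, (i <= M)%N -> f i = g i.
Proof. by move=> /truncate_eqP fg i le_iM; have := fg i le_iM; rewrite !coef_poly ltnS le_iM. Qed.

Lemma eq_series f g : (forall i, f i = g i) -> series f = series g.
Proof. by move=> fg; apply: truncate_series => i le_iM; rewrite coef_poly ltnS le_iM fg. Qed.

Lemma seriesM f g : series f * series g = series (convolution f g).
Proof.
rewrite -rmorphM; apply: truncate_series => i le_iM; rewrite coefM.
apply: eq_bigr => j _; have := ltn_ord j; rewrite ltnS => le_ji.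
by rewrite !coef_poly !ltnS (leq_trans le_ji le_iM) (leq_trans (leq_subr _ _) le_iM).
Qed.

Lemma seriesD f g : series f + series g = series (fun n => f n + g n).
Proof.
by rewrite -rmorphD; apply: truncate_series => i le_iM; rewrite coefD !coef_poly ltnS le_iM.
Qed.

Lemma seriesMn f k : k%:R * series f = series (fun n => k%:R * f n).
Proof.
rewrite mulr_natl -rmorphMn; apply: truncate_series => i le_iM.
by rewrite coefMn coef_poly ltnS le_iM mulr_natl.
Qed.

Lemma seriesN f : - series f = series (fun n => - f n).
Proof.
by rewrite -rmorphN; apply: truncate_series => i le_iM; rewrite coefN coef_poly ltnS le_iM.
Qed.

Definition seriesX : truncation := truncate 'X.

Lemma series_shift b f : seriesX ^+ b * series f = series (shift b f).
Proof.
rewrite -rmorphXn -rmorphM; apply: truncate_series => i le_iM.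
rewrite coefXnM /shift; case: ltnP => // le_bi.
by rewrite coef_poly ltnS (leq_trans (leq_subr _ _) le_iM).
Qed.

Lemma series_sum (I : finType) (P : pred I) (f : I -> nat -> rat) :
  \sum_(i | P i) series (f i) = series (fun n => \sum_(i | P i) f i n).
Proof.
rewrite -rmorph_sum; apply: truncate_series => i le_iM.
by rewrite coef_sum; apply: eq_bigr => j _; rewrite coef_poly ltnS le_iM.
Qed.

End TruncatedSeries.

(** * Powers of 1 - 4 x *)

(** The coefficient of x^n in (1 - 4 x)^(-a). *)
Definition binomial_coef (a : rat) (n : nat) : rat :=
  \prod_(i < n) (4%:R * (a + i%:R) / i.+1%:R).

Lemma binomial_coef0 a : binomial_coef a 0 = 1.
Proof. by rewrite /binomial_coef big_ord0. Qed.

Lemma binomial_coefS a n :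
  n.+1%:R * binomial_coef a n.+1 = 4%:R * (a + n%:R) * binomial_coef a n.
Proof. by rewrite /binomial_coef big_ord_recr /=; field; rewrite ?natr1 ?nat1r pnatr_eq0. Qed.

(** The Chu-Vandermonde identity, proved by the first-order recurrence in n that
    (1 - 4 x) y' = 4 a y gives for the coefficients of y = (1 - 4 x)^(-a). *)
Lemma binomial_coef_convolution a b n :
  convolution (binomial_coef a) (binomial_coef b) n = binomial_coef (a + b) n.
Proof.
elim: n => [|n IHn]; first by rewrite /convolution big_ord1 !binomial_coef0 mulr1.
have nz : n.+1%:R != 0 :> rat by rewrite pnatr_eq0.
apply: (mulfI nz); rewrite binomial_coefS -{}IHn /convolution !mulr_sumr.
set ca := binomial_coef a; set cb := binomial_coef b.
transitivity (\sum_(i < n.+2) (i%:R * ca i * cb (n.+1 - i)%N)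
            + \sum_(i < n.+2) ((n.+1 - i)%:R * cb (n.+1 - i)%N * ca i)).
  rewrite -big_split; apply: eq_bigr => i _ /=.
  have -> : n.+1%:R = i%:R + (n.+1 - i)%:R :> rat by rewrite -natrD subnKC // -ltnS.
  by ring.
rewrite big_ord_recl [X in _ + X]big_ord_recr /= subnn !mul0r add0r addr0 -big_split /=.
apply: eq_bigr => i _; have le_in : (i <= n)%N by rewrite -ltnS.
rewrite /bump /= add1n subSS subSn // !binomial_coefS -/ca -/cb natrB //; ring.
Qed.

Definition central_binomial (n : nat) : rat := 'C(2 * n, n)%:R.

Lemma central_binomial0 : central_binomial 0 = 1.
Proof. by rewrite /central_binomial bin0. Qed.

Lemma central_binomial_odd n :
  n.+1%:R * 'C(2 * n + 1, n)%:R = (2 * n + 1)%:R * central_binomial n.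
Proof.
rewrite /central_binomial -!natrM; congr _%:R.
have := mul_bin_down (2 * n).+1 n; rewrite /= addn1 => ->; congr (_ * _)%N; lia.
Qed.

Lemma central_binomialS n :
  n.+1%:R * central_binomial n.+1 = (4 * n + 2)%:R * central_binomial n.
Proof.
have nz : (n.+1%:R != 0 :> rat) by rewrite pnatr_eq0.
have h := mul_bin_diag (2 * n.+1) n; rewrite (_ : (2 * n.+1).-1 = 2 * n + 1)%N in h; last lia.
have {}h := congr1 (fun k => k%:R : rat) h; rewrite !natrM in h.
rewrite -[LHS]h -mulrA central_binomial_odd mulrA; congr (_ * _).
by rewrite -natrM; congr _%:R; lia.
Qed.

Lemma central_binomial4 : central_binomial 4 = 70%:R.
Proof. by rewrite /central_binomial (_ : 'C(_, _) = 70)%N. Qed.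

Lemma central_binomial5 : central_binomial 5 = 252%:R.
Proof. by rewrite /central_binomial (_ : 'C(_, _) = 252)%N. Qed.

Lemma central_binomial6 : central_binomial 6 = 924%:R.
Proof. by rewrite /central_binomial (_ : 'C(_, _) = 924)%N. Qed.

Lemma central_binomial7 : central_binomial 7 = 52%:R * 66%:R.
Proof. by rewrite -natrM /central_binomial (_ : 'C(_, _) = 52 * 66)%N. Qed.

Lemma central_binomial8 : central_binomial 8 = 90%:R * 143%:R.
Proof. by rewrite -natrM /central_binomial (_ : 'C(_, _) = 90 * 143)%N. Qed.

Lemma central_binomial_ind (f : nat -> rat) (P : nat -> rat) b :
    f b = central_binomial b * P b ->
    (forall n, (b <= n)%N -> f n = central_binomial n * P n ->
       f n.+1 = central_binomial n * ((4 * n + 2)%:R / n.+1%:R) * P n.+1) ->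
  forall n, (b <= n)%N -> f n = central_binomial n * P n.
Proof.
move=> f0 fS; elim=> [|n IHn]; first by rewrite leqn0 => /eqP b0; rewrite -b0.
rewrite leq_eqVlt => /predU1P[<- //|le_bn]; rewrite (fS n le_bn (IHn le_bn)).
have nz : n.+1%:R != 0 :> rat by rewrite pnatr_eq0.
by congr (_ * _); apply: (mulfI nz); rewrite central_binomialS; field; rewrite ?natr1 ?nat1r nz.
Qed.

(** * The numbers of one-face gluings of genus at most three *)

(** The Harer-Zagier recurrence, carrying along the previous term. *)
Fixpoint genus_poly_pair (n : nat) : {poly rat} * {poly rat} :=
  match n with
  | 0 => (1, 0)
  | m.+1 =>
    let: (p, q) := genus_poly_pair m in
    ((m.+2%:R)^-1 *: ((4 * m + 2)%:R *: p
        + (m%:R * (4%:R * m%:R ^+ 2 - 1)) *: ('X * q)), p)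
  end.

(** Its coefficient of degree g counts the gluings of a 2n-gon into a surface of
    genus g; see trace_mean_genus. *)
Definition genus_poly n := (genus_poly_pair n).1.

Lemma genus_poly0 : genus_poly 0 = 1. Proof. by []. Qed.

Lemma genus_polyS n :
  n.+2%:R *: genus_poly n.+1 = (4 * n + 2)%:R *: genus_poly n
     + (n%:R * (4%:R * n%:R ^+ 2 - 1)) *: ('X * genus_poly n.-1).
Proof.
have nz : n.+2%:R != 0 :> rat by rewrite pnatr_eq0.
rewrite /genus_poly /=; case eq_n: (genus_poly_pair n) => [p q] /=.
rewrite scalerA divff // scale1r; congr (_ + _).
case: n eq_n {nz} => [|n] /=; first by rewrite !mul0r !scale0r.
by case: (genus_poly_pair n) => p' q' [_ ->].
Qed.

Lemma horner_genus_polyS n y :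
  n.+2%:R * (genus_poly n.+1).[y] = (4 * n + 2)%:R * (genus_poly n).[y]
     + n%:R * (4%:R * n%:R ^+ 2 - 1) * (y * (genus_poly n.-1).[y]).
Proof.
have := congr1 (fun p : {poly rat} => p.[y]) (genus_polyS n).
by rewrite hornerZ hornerD !hornerZ hornerM hornerX.
Qed.

Definition genus_count g n : rat := (genus_poly n)`_g.

Lemma genus_countS g n :
  n.+2%:R * genus_count g n.+1 = (4 * n + 2)%:R * genus_count g n
     + n%:R * (4%:R * n%:R ^+ 2 - 1) * (if g is h.+1 then genus_count h n.-1 else 0).
Proof.
have := congr1 (fun p : {poly rat} => p`_g) (genus_polyS n).
by rewrite /genus_count !(coefZ, coefD) coefXM; case: g.
Qed.

(** Dividing by the central binomial coefficient makes the recurrence for the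
    numbers of gluings rational, with rational functions of n as solutions. *)
Lemma genus_count_ind g (P0 P : nat -> rat) :
    (forall n, (if g is h.+1 then genus_count h n else 0) = central_binomial n * P0 n) ->
    genus_count g 0 = P 0%N ->
    (forall n, 4%:R * n.+2%:R * P n.+1 =
       4%:R * n.+1%:R * P n + n%:R ^+ 2 * n.+1%:R * P0 n.-1) ->
  forall n, genus_count g n = central_binomial n * P n.
Proof.
have nz k : k.+1%:R != 0 :> rat by rewrite pnatr_eq0.
move=> gP0 P_0 PS; elim=> [|n IHn]; first by rewrite central_binomial0 mul1r.
apply: (mulfI (nz n.+1)); apply: (mulfI (nz n)).
rewrite genus_countS IHn gP0 [X in _ = _ * X]mulrCA [RHS]mulrA central_binomialS.
have := PS n; case: n {IHn} => [|n] PSn /=.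
  by rewrite !mul0r addr0 mul1r central_binomial0 !mul1r !mulr1 in PSn *; lra.
have w1 := central_binomialS n.
have e : central_binomial n = n.+1%:R * central_binomial n.+1 / (4 * n + 2)%:R.
  by rewrite w1 mulrC mulKf // addn2 nz.
rewrite e.
have -> : n.+3%:R * P n.+2 = (4%:R * n.+2%:R * P n.+1 + n.+1%:R ^+ 2 * n.+2%:R * P0 n) / 4%:R.
  by rewrite -PSn; field.
have nz2 : (4 * n + 2)%:R != 0 :> rat by rewrite addn2 nz.
have -> : (4 * n.+1 + 2)%:R = 4%:R * n%:R + 6%:R :> rat by rewrite mulnS natrD natrD natrM -addrA addrC -addrA -natrD.
move: nz2; have -> : (4 * n + 2)%:R = 4%:R * n%:R + 2%:R :> rat by rewrite natrD natrM.
have -> : n.+2%:R = n%:R + 2%:R :> rat by rewrite -addn2 natrD.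
have -> : n.+1%:R = n%:R + 1 :> rat by rewrite -natr1.
by move=> nz2; field.
Qed.

Definition genus0 (n : nat) : rat := n.+1%:R^-1.
Definition genus1 (n : nat) : rat := n%:R * (n%:R - 1) / 12%:R.

(** The denominator is 1440; here and below large constants are factored, because
    numerals are unary. *)
Definition genus2 (n : nat) : rat :=
  n%:R * (n%:R - 1) * (n%:R - 2%:R) * (n%:R - 3%:R) * (5%:R * n%:R - 2%:R) / (12%:R * 12%:R * 10%:R).

(** The denominator is 9!. *)
Definition genus3 (n : nat) : rat :=
  n%:R * (n%:R - 1) * (n%:R - 2%:R) * (n%:R - 3%:R) * (n%:R - 4%:R) * (n%:R - 5%:R)
  * (35%:R * n%:R ^+ 2 - 77%:R * n%:R + 12%:R) / (72%:R * 72%:R * 70%:R).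

Lemma genus_count0 n : genus_count 0 n = central_binomial n * genus0 n.
Proof.
apply: (@genus_count_ind _ (fun _ => 0)) => [k||k].
- by rewrite mulr0.
- by rewrite /genus_count genus_poly0 coef1 /genus0 invr1.
rewrite /genus0 mulr0 addr0 -!mulrA !divff ?pnatr_eq0 //.
Qed.

Lemma genus_count1 n : genus_count 1 n = central_binomial n * genus1 n.
Proof.
apply: (@genus_count_ind 1 genus0) => [|| k]; first exact: genus_count0.
  by rewrite /genus_count genus_poly0 coef1 /genus1 !mul0r.
case: k => [|k]; first by rewrite /genus1 /=; ring.
rewrite /genus1 /genus0 /= -!natr1; field.
by rewrite natr1 pnatr_eq0.
Qed.

Lemma genus_count2 n : genus_count 2 n = central_binomial n * genus2 n.
Proof.
apply: (@genus_count_ind 2 genus1) => [|| k]; first exact: genus_count1.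
  by rewrite /genus_count genus_poly0 coef1 /genus2 !mul0r.
by case: k => [|k]; rewrite /genus2 /genus1 /= -?natr1; field.
Qed.

Lemma genus_count3 n : genus_count 3 n = central_binomial n * genus3 n.
Proof.
apply: (@genus_count_ind 3 genus2) => [|| k]; first exact: genus_count2.
  by rewrite /genus_count genus_poly0 coef1 /genus3 !mul0r.
by case: k => [|k]; rewrite /genus3 /genus2 /= -?natr1; field.
Qed.

(** The solution of genus g is a combination of odd powers of (1 - 4 x)^(-1/2);
    each of them has coefficients of the same shape. *)
Lemma shift_binomial_coef (P : nat -> rat) b a :
    (forall n, (n < b)%N -> P n = 0) ->
    central_binomial b * P b = 1 ->
    (forall j, (j%:R + 1) * (4%:R * (j + b)%:R + 2%:R) * P (j + b).+1 =
       4%:R * (a + j%:R) * ((j + b)%:R + 1) * P (j + b)%N) ->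
  forall n, shift b (binomial_coef a) n = central_binomial n * P n.
Proof.
move=> P_0 P_b PS n; rewrite /shift; case: ltnP => [/P_0->|]; first by rewrite mulr0.
apply: (@central_binomial_ind (fun n => binomial_coef a (n - b))); first by rewrite subnn binomial_coef0.
move=> {}n le_bn; rewrite subSn //; set j := (n - b)%N => IH.
have nz k : k.+1%:R != 0 :> rat by rewrite pnatr_eq0.
have := PS j; rewrite (subnK le_bn) !natr1 => PSj.
apply: (mulfI (nz j)); rewrite binomial_coefS IH.
have -> : (4 * n + 2)%:R = 4%:R * n%:R + 2%:R :> rat by rewrite natrD natrM.
transitivity (central_binomial n * (j.+1%:R * (4%:R * n%:R + 2%:R) * P n.+1) / n.+1%:R); last first.
  by field; rewrite ?natr1 ?nat1r nz.
by rewrite PSj; field; rewrite ?natr1 ?nat1r nz.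
Qed.

(** * Three faces and genus one *)

(** The product of generating functions in x whose coefficients are polynomials in
    the variable that marks the genus. *)
Definition poly_convolution (P R : nat -> {poly rat}) (n : nat) : {poly rat} :=
  \sum_(i < n.+1) P i * R (n - i)%N.

Lemma series_poly_convolution M P R g :
  series M (fun n => (poly_convolution P R n)`_g) =
    \sum_(h < g.+1) series M (fun n => (P n)`_h) * series M (fun n => (R n)`_(g - h)).
Proof.
under [RHS]eq_bigr do rewrite seriesM.
rewrite series_sum; apply: eq_series => n; rewrite /poly_convolution coef_sum /convolution exchange_big /=.
by apply: eq_bigr => i _; rewrite coefM.
Qed.

(** The coefficients of (1 - 4 x)^(-k/2). *)
Definition half_power (k : nat) : nat -> rat := binomial_coef (k%:R / 2%:R).

(** By its quadratic equation the Catalan series e0 cancels out of the corrections for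
    disconnected gluings, so that only odd powers of r = (1 - 4 x)^(-1/2) remain. *)
Lemma three_faces_identity (A : comNzRingType) (x r s e0 e1 e2 e3 : A) :
    r * s = 1 -> s ^+ 2 = 1 - 4%:R * x -> 2%:R * x * e0 = 1 - s ->
    e1 = x ^+ 2 * r ^+ 5 ->
    e2 = 21%:R * (x ^+ 4 * r ^+ 11 + x ^+ 5 * r ^+ 11) ->
    e3 = 11%:R * (158%:R * (x ^+ 8 * r ^+ 17) + 558%:R * (x ^+ 7 * r ^+ 17)
                  + 135%:R * (x ^+ 6 * r ^+ 17)) ->
  2%:R * (e3 + 2%:R * (x ^+ 1 * e3) - 3%:R * (x ^+ 1 * (2%:R * (e0 * e3 + e1 * e2)))
     + 2%:R * (x ^+ 2 * (3%:R * e0 ^+ 2 * e3 + 6%:R * e0 * e1 * e2 + e1 ^+ 3))) =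
  2%:R * ((15 * 99)%:R * (x ^+ 6 * r ^+ 15) + (60 * 100 + 12)%:R * (x ^+ 7 * r ^+ 15)
      + (16 * 100 + 14)%:R * (x ^+ 8 * r ^+ 15)).
Proof.
move=> rs ss e0E e1E e2E e3E.
transitivity (e3 * (2%:R + 4%:R * x - 6%:R * (2%:R * x * e0) + 3%:R * (2%:R * x * e0) ^+ 2)
   + e1 * e2 * (12%:R * x * (2%:R * x * e0) - 12%:R * x) + 4%:R * x ^+ 2 * e1 ^+ 3).
  by ring.
have hx : 4%:R * x = 1 - s ^+ 2 by rewrite ss; ring.
rewrite e0E hx e1E e2E e3E.
have hr : r ^+ 17 * s ^+ 2 = r ^+ 15.
  by rewrite -[17%N]/(15 + 2)%N exprD -mulrA -exprMn rs expr1n mulr1.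
have hr' : r ^+ 16 * s = r ^+ 15 by rewrite exprSr -mulrA rs mulr1.
transitivity (22%:R * x ^+ 6 * (158%:R * x ^+ 2 + 558%:R * x + 135%:R) * (r ^+ 17 * s ^+ 2)
   - 252%:R * x ^+ 7 * (1 + x) * (r ^+ 16 * s) + 4%:R * x ^+ 8 * r ^+ 15); last first.
  by rewrite hr hr'; ring.
by ring.
Qed.

Lemma convolution_pair (A : comNzRingType) (e0 e1 e2 e3 : A) :
  e0 * e3 + (e1 * e2 + (e2 * e1 + (e3 * e0 + 0))) = 2%:R * (e0 * e3 + e1 * e2).
Proof. by ring. Qed.

Lemma convolution_triple (A : comNzRingType) (e0 e1 e2 e3 : A) :
  e0 * (e0 * e3 + (e1 * e2 + (e2 * e1 + (e3 * e0 + 0))))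
  + (e1 * (e0 * e2 + (e1 * e1 + (e2 * e0 + 0)))
  + (e2 * (e0 * e1 + (e1 * e0 + 0)) + (e3 * (e0 * e0 + 0) + 0))) =
  3%:R * e0 ^+ 2 * e3 + 6%:R * e0 * e1 * e2 + e1 ^+ 3.
Proof. by ring. Qed.

Section GeneratingFunctions.
Variable M : nat.
Let x := seriesX M.
Let r := series M (half_power 1).
Let s := series M (binomial_coef (- (1 / 2%:R))).
Let e g := series M (genus_count g).

Lemma series_half_power k : series M (half_power k) = r ^+ k.
Proof.
elim: k => [|k IHk].
  rewrite /half_power mul0r expr0 -(rmorph1 (truncate M)); symmetry.
  apply: truncate_series => -[|i] _; rewrite coef1 ?binomial_coef0 //.
  by rewrite /binomial_coef big_ord_recl /= addr0 mulr0 mul0r mul0r.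
rewrite exprS -IHk seriesM; apply: eq_series => n; rewrite binomial_coef_convolution.
by rewrite /half_power -natr1 addrC mulrDl.
Qed.

Lemma series_rs : r * s = 1.
Proof.
rewrite seriesM -(rmorph1 (truncate M)); symmetry; apply: truncate_series => i _.
rewrite binomial_coef_convolution subrr coef1; case: i => [|i]; first by rewrite binomial_coef0.
by rewrite /binomial_coef big_ord_recl /= addr0 mulr0 mul0r mul0r.
Qed.

Lemma series_ss : s ^+ 2 = 1 - 4%:R * x.
Proof.
rewrite expr2 seriesM mulr_natl /x /seriesX -(rmorph1 (truncate M)) -rmorphMn -rmorphB.
symmetry; apply: truncate_series => i _.
rewrite binomial_coef_convolution (_ : - (1 / 2%:R) + - (1 / 2%:R) = -1 :> rat); last by field.
rewrite coefB coefMn coef1 coefX.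
case: i => [|[|i]]; first by rewrite binomial_coef0 mul0rn subr0.
  by rewrite /binomial_coef big_ord1.
by rewrite /binomial_coef !big_ord_recl /= mul0rn subr0 addNr !(mulr0, mul0r).
Qed.

(** The Catalan generating function is (1 - sqrt (1 - 4 x)) / (2 x). *)
Lemma series_e0 : 2%:R * x * e 0 = 1 - s.
Proof.
have -> : 2%:R * x * e 0 = series M (shift 1 (fun n => 2%:R * genus_count 0 n)).
  by rewrite -mulrA mulrCA -[x]expr1 seriesMn series_shift.
rewrite -(rmorph1 (truncate M)) -rmorphB; symmetry; apply: truncate_series => i le_iM.
rewrite coefB coef1 coef_poly ltnS le_iM /shift.
case: i le_iM => [|i] _; first by rewrite binomial_coef0 subrr.
rewrite subn1 /= genus_count0 sub0r; elim: i => [|i IHi].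
  by rewrite /binomial_coef big_ord1 /= central_binomial0 /genus0; field.
have nz k : k.+1%:R != 0 :> rat by rewrite pnatr_eq0.
apply: (mulfI (nz i.+1)); rewrite mulrN binomial_coefS -mulrN IHi.
rewrite [RHS]mulrCA (mulrCA i.+2%:R) /genus0 divff // mulr1.
apply: (mulfI (nz i)); rewrite [RHS]mulrCA central_binomialS.
have -> : (4 * i + 2)%:R = 4%:R * i%:R + 2%:R :> rat by rewrite natrD natrM.
by field; rewrite ?natr1 ?nat1r nz.
Qed.

Lemma series_e1 : e 1 = x ^+ 2 * r ^+ 5.
Proof.
rewrite -series_half_power series_shift; apply: eq_series => n.
rewrite genus_count1 /half_power (@shift_binomial_coef genus1) //.
- by move=> [|[|k]] //= _; rewrite /genus1; ring.
by move=> j; rewrite /genus1 -natr1 natrD; field.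
Qed.

(** P4 and P5 are the coefficients of x^4 r^11 and x^5 r^11 over the central binomial
    coefficient. *)
Lemma series_e2 : e 2 = 21%:R * (x ^+ 4 * r ^+ 11 + x ^+ 5 * r ^+ 11).
Proof.
pose u n : rat := n%:R * (n%:R - 1) * (n%:R - 2%:R) * (n%:R - 3%:R) / (120%:R * 126%:R).
pose P4 n : rat := u n * (2%:R * n%:R + 1).
pose P5 n : rat := u n * (n%:R - 4%:R) / 2%:R.
rewrite -series_half_power !series_shift seriesD seriesMn; apply: eq_series => n.
rewrite genus_count2 /half_power (@shift_binomial_coef P4 4) ?(@shift_binomial_coef P5 5).
- by rewrite /P4 /P5 /u /genus2; field.
- by move=> [|[|[|[|[|k]]]]] lt_k; last (by case: (notF lt_k)); rewrite /P5 /u; field.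
- by rewrite central_binomial5 /P5 /u; field.
- by move=> j; rewrite /P5 /u -natr1 natrD; field.
- by move=> [|[|[|[|k]]]] lt_k; last (by case: (notF lt_k)); rewrite /P4 /u; field.
- by rewrite central_binomial4 /P4 /u; field.
by move=> j; rewrite /P4 /u -natr1 natrD; field.
Qed.

(** P6, P7 and P8 are the coefficients of x^6 r^17, x^7 r^17 and x^8 r^17 over the
    central binomial coefficient. *)
Lemma series_e3 :
  e 3 = 11%:R * (158%:R * (x ^+ 8 * r ^+ 17) + 558%:R * (x ^+ 7 * r ^+ 17)
                  + 135%:R * (x ^+ 6 * r ^+ 17)).
Proof.
pose u n : rat := n%:R * (n%:R - 1) * (n%:R - 2%:R) * (n%:R - 3%:R) * (n%:R - 4%:R)
  * (n%:R - 5%:R) / (924%:R * 720%:R * 195%:R).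
pose P6 n : rat := u n * (2%:R * n%:R + 1) * (2%:R * n%:R + 3%:R).
pose P7 n : rat := u n * (2%:R * n%:R + 1) * (n%:R - 6%:R) / 2%:R.
pose P8 n : rat := u n * (n%:R - 6%:R) * (n%:R - 7%:R) / 4%:R.
rewrite -series_half_power !series_shift !seriesMn !seriesD seriesMn; apply: eq_series => n.
rewrite genus_count3 /half_power (@shift_binomial_coef P6 6) ?(@shift_binomial_coef P7 7)
  ?(@shift_binomial_coef P8 8).
- by rewrite /P6 /P7 /P8 /u /genus3; field.
- by move=> [|[|[|[|[|[|[|[|k]]]]]]]] lt_k; last (by case: (notF lt_k)); rewrite /P8 /u; field.
- by rewrite central_binomial8 /P8 /u; field.
- by move=> j; rewrite /P8 /u -natr1 natrD; field.
- by move=> [|[|[|[|[|[|[|k]]]]]]] lt_k; last (by case: (notF lt_k)); rewrite /P7 /u; field.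
- by rewrite central_binomial7 /P7 /u; field.
- by move=> j; rewrite /P7 /u -natr1 natrD; field.
- by move=> [|[|[|[|[|[|k]]]]]] lt_k; last (by case: (notF lt_k)); rewrite /P6 /u; field.
- by rewrite central_binomial6 /P6 /u; field.
by move=> j; rewrite /P6 /u -natr1 natrD; field.
Qed.

Lemma series_genus3_pairs :
  series M (fun n => (poly_convolution genus_poly genus_poly n)`_3) =
    2%:R * (e 0 * e 3 + e 1 * e 2).
Proof.
rewrite series_poly_convolution !big_ord_recl big_ord0.
exact: convolution_pair.
Qed.

Lemma series_genus3_triples :
  series M (fun n => (poly_convolution genus_poly
                        (poly_convolution genus_poly genus_poly) n)`_3) =
    3%:R * e 0 ^+ 2 * e 3 + 6%:R * e 0 * e 1 * e 2 + e 1 ^+ 3.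
Proof.
rewrite series_poly_convolution !big_ord_recl big_ord0 !series_poly_convolution.
rewrite !big_ord_recl !big_ord0.
exact: convolution_triple.
Qed.

End GeneratingFunctions.

Lemma natr_ffact n m : (n ^_ m)%:R = \prod_(i < m) (n%:R - i%:R) :> rat.
Proof.
elim: m => [|m IHm]; first by rewrite big_ord0.
rewrite big_ord_recr /= -IHm ffactnSr natrM; case: (leqP m n) => [le_mn|lt_nm].
  by rewrite natrB.
by rewrite ffact_small // !mul0r.
Qed.

(** The three constants, kept factored, are 1485, 6012 and 1614. *)
Lemma three_faces_series n :
  genus_count 3 n.+2 + 2%:R * genus_count 3 n.+1
  - 3%:R * (poly_convolution genus_poly genus_poly n.+1)`_3
  + 2%:R * (poly_convolution genus_poly (poly_convolution genus_poly genus_poly) n)`_3 =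
    (15 * 99)%:R * shift 4 (half_power 15) n + (60 * 100 + 12)%:R * shift 5 (half_power 15) n
    + (16 * 100 + 14)%:R * shift 6 (half_power 15) n.
Proof.
have key := three_faces_identity (series_rs n.+2) (series_ss n.+2)
  (series_e0 n.+2) (series_e1 n.+2) (series_e2 n.+2) (series_e3 n.+2).
rewrite -series_genus3_pairs -series_genus3_triples -series_half_power in key.
rewrite !(series_shift, seriesMn, seriesN, seriesD) in key.
have := series_inj key (leqnn n.+2); rewrite {1 2 3}/shift /= subn1 subn2 /=.
by apply: mulfI; rewrite pnatr_eq0.
Qed.

(** Every term is the central binomial coefficient times a rational function of n,
    so the identity becomes one between rational functions. *)
Lemma three_faces_genus1 n :
  genus_count 3 n.+2 + 2%:R * genus_count 3 n.+1
  - 3%:R * (poly_convolution genus_poly genus_poly n.+1)`_3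
  + 2%:R * (poly_convolution genus_poly (poly_convolution genus_poly genus_poly) n)`_3
  - n.+1%:R * (2 * n + 1)%:R * genus_count 2 n =
    (808%:R * n%:R ^+ 2 + 99%:R * n%:R - 454%:R) / 3003%:R
      * 'C(2 * n + 1, n)%:R * 'C(n + 1, 5)%:R.
Proof.
pose u k : rat := k%:R * (k%:R - 1) * (k%:R - 2%:R) * (k%:R - 3%:R) / (70%:R * 24%:R * 13%:R * 99%:R).
pose P4 k : rat := u k * (2%:R * k%:R + 1) * (2%:R * k%:R + 3%:R) * (2%:R * k%:R + 5%:R).
pose P5 k : rat := u k * (2%:R * k%:R + 1) * (2%:R * k%:R + 3%:R) * (k%:R - 4%:R) / 2%:R.
pose P6 k : rat := u k * (2%:R * k%:R + 1) * (k%:R - 4%:R) * (k%:R - 5%:R) / 4%:R.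
have nz : n.+1%:R != 0 :> rat by rewrite pnatr_eq0.
have -> : 'C(2 * n + 1, n)%:R = (2%:R * n%:R + 1) * central_binomial n / n.+1%:R :> rat.
  by have := central_binomial_odd n; rewrite natrD natrM => <-; rewrite mulrAC divff ?mul1r.
have -> : 'C(n + 1, 5)%:R = (n%:R + 1) * n%:R * (n%:R - 1) * (n%:R - 2%:R) * (n%:R - 3%:R) / 120%:R :> rat.
  have := congr1 (fun k => k%:R : rat) (bin_ffact (n + 1) 5).
  rewrite natrM natr_ffact !big_ord_recr big_ord0 /= natrD (_ : 5`! = 120)%N // => h.
  apply: (@mulIf _ (120%:R : rat)); first by rewrite pnatr_eq0.
  by rewrite h; field.
rewrite three_faces_series genus_count2 /genus2 /half_power (@shift_binomial_coef P4 4)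
  ?(@shift_binomial_coef P5 5) ?(@shift_binomial_coef P6 6).
- rewrite /P4 /P5 /P6 /u natrD natrM -natr1; field.
  by rewrite ?natr1 ?nat1r nz.
- by move=> [|[|[|[|[|[|k]]]]]] lt_k; last (by case: (notF lt_k)); rewrite /P6 /u; field.
- by rewrite central_binomial6 /P6 /u; field.
- by move=> j; rewrite /P6 /u -natr1 natrD; field.
- by move=> [|[|[|[|[|k]]]]] lt_k; last (by case: (notF lt_k)); rewrite /P5 /u; field.
- by rewrite central_binomial5 /P5 /u; field.
- by move=> j; rewrite /P5 /u -natr1 natrD; field.
- by move=> [|[|[|[|k]]]] lt_k; last (by case: (notF lt_k)); rewrite /P4 /u; field.
- by rewrite central_binomial4 /P4 /u; field.
by move=> j; rewrite /P4 /u -natr1 natrD; field.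
Qed.

(** * Summing the loop equations over all polygon sizes *)

(** The symmetric form of a sum over the triples of sum d, convenient for permuting
    the three indices. *)
Definition triangle_sum (d : nat) (F : nat -> nat -> nat -> rat) : rat :=
  \sum_(a < d.+1) \sum_(b < d.+1) \sum_(c < d.+1 | (a + b + c == d)%N) F a b c.

Lemma triangle_sumE d F :
  triangle_sum d F = \sum_(a < d.+1) \sum_(b < (d - a).+1) F a b (d - a - b)%N.
Proof.
apply: eq_bigr => a _; have le_ad : (a <= d)%N by rewrite -ltnS.
have le_d : ((d - a).+1 <= d.+1)%N by rewrite ltnS leq_subr.
rewrite (big_ord_widen _ (fun b => F a b (d - a - b)%N) le_d) [RHS]big_mkcond /=.
apply: eq_bigr => b _; rewrite ltnS; case: leqP => [le_b|lt_b]; last first.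
  by rewrite big_pred0 // => c; apply/negbTE; lia.
have lt_c : (d - a - b < d.+1)%N by lia.
rewrite (big_pred1 (Ordinal lt_c)) // => c /=; rewrite -val_eqE /=.
by apply/eqP/eqP; lia.
Qed.

Lemma triangle_sum_swap12 d F :
  triangle_sum d F = triangle_sum d (fun a b c => F b a c).
Proof.
rewrite /triangle_sum exchange_big; apply: eq_bigr => a _; apply: eq_bigr => b _.
by apply: eq_bigl => c; rewrite [(b + a)%N]addnC.
Qed.

Lemma triangle_sum_swap23 d F :
  triangle_sum d F = triangle_sum d (fun a b c => F a c b).
Proof.
apply: eq_bigr => a _.
under eq_bigr do rewrite big_mkcond; rewrite exchange_big; apply: eq_bigr => b _ /=.
by rewrite [RHS]big_mkcond; apply: eq_bigr => c _; rewrite addnAC.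
Qed.

Lemma eq_triangle_sum d F G : (forall a b c, (a + b + c)%N = d -> F a b c = G a b c) ->
  triangle_sum d F = triangle_sum d G.
Proof.
by move=> FG; do 2![apply: eq_bigr => ? _]; apply: eq_bigr => c /eqP/FG.
Qed.

Lemma triangle_sumD d F G :
  triangle_sum d (fun a b c => F a b c + G a b c) = triangle_sum d F + triangle_sum d G.
Proof.
rewrite /triangle_sum -big_split; apply: eq_bigr => a _ /=.
by rewrite -big_split; apply: eq_bigr => b _ /=; rewrite -big_split.
Qed.

Lemma triangle_sumZ d k F :
  triangle_sum d (fun a b c => k * F a b c) = k * triangle_sum d F.
Proof.
rewrite /triangle_sum mulr_sumr; apply: eq_bigr => a _.
by rewrite mulr_sumr; apply: eq_bigr => b _; rewrite mulr_sumr.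
Qed.

Lemma sum_even (F : nat -> rat) n : (forall k, F k.*2.+1 = 0) ->
  \sum_(a < (2 * n).+1) F a = \sum_(i < n.+1) F (2 * i)%N.
Proof.
move=> F_odd; elim: n => [|n IHn]; first by rewrite !big_ord1.
rewrite (_ : (2 * n.+1).+1 = (2 * n).+3)%N; last lia.
rewrite big_ord_recr big_ord_recr IHn [RHS]big_ord_recr /=.
rewrite (_ : (2 * n).+1 = n.*2.+1)%N; last lia.
by rewrite F_odd addr0; congr (_ + F _); lia.
Qed.

Section LoopSums.
Variable N : nat.
Hypothesis N_gt0 : (0 < N)%N.

Notation T1 a := (trace_mean (power_sum N a)).
Notation T2 a b := (trace_mean (power_sum N a * power_sum N b)).
Notation T3 a b c := (trace_mean (power_sum N a * power_sum N b * power_sum N c)).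

(** The loop equation of one polygon sums over all pairs of polygons with d edges in
    total, so these need no computation of their own. *)
Lemma trace_mean_loop1 d : T1 (d + 2)%N = \sum_(k < d.+1) T2 k (d - k)%N.
Proof.
have := trace_mean_loop d.+1 (1 : {mpoly rat[N]}).
by rewrite mulr1 power_field1 raddf0 addr0 addn2 => ->; apply: eq_bigr => k _; rewrite mulr1.
Qed.

Lemma trace_mean_loop2 a b :
  T2 a.+1 b = \sum_(k < a) T3 k (a - k.+1)%N b + b%:R * T1 (a + b).-1.
Proof. by rewrite trace_mean_loop power_field_power_sum trace_meanZ. Qed.

Lemma trace_mean_power_sum0 f : trace_mean (power_sum N 0 * f) = N%:R * trace_mean f.
Proof. by rewrite power_sum0 -(rmorph_nat (@mpolyC N rat)) mul_mpolyC trace_meanZ. Qed.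

(** Summed over all sizes, the loop equation of two polygons produces all triples.
    In the merging term the mean does not depend on how the edges are shared, so the
    number of choices b adds up to a binomial coefficient. *)
Lemma triangle_sum_T3 d :
  triangle_sum d (fun a b c => T3 a b c) =
    T1 (d + 4)%N - N%:R * T1 (d + 2)%N - (d.+1 * d.+2)%:R / 2%:R * T1 d.
Proof.
have := trace_mean_loop1 d.+2; rewrite -addn2 -addnA => ->.
rewrite addn2 big_ord_recl subn0 trace_mean_power_sum0.
rewrite (eq_bigr (fun i : 'I_d.+2 => \sum_(k < i) T3 k (i - k.+1)%N (d.+2 - i.+1)%N
    + (d.+2 - i.+1)%:R * T1 (i + (d.+2 - i.+1)).-1)) => [|i _]; last exact: trace_mean_loop2.
rewrite big_split /=.
have -> : \sum_(i < d.+2) (d.+2 - i.+1)%:R * T1 (i + (d.+2 - i.+1)).-1 =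
   (d.+1 * d.+2)%:R / 2%:R * T1 d.
  transitivity (\sum_(i < d.+2) i%:R * T1 d).
    rewrite [RHS](reindex_inj rev_ord_inj); apply: eq_bigr => i _ /=; have := ltn_ord i => lt_i.
    by congr (_%:R * trace_mean (power_sum N _)); lia.
  rewrite -mulr_suml; congr (_ * _); elim: (d.+1) => [|k IHk]; first by rewrite big_ord1 !mul0r.
  by rewrite big_ord_recr /= IHk !natrM -!natr1; field.
have -> : \sum_(i < d.+2) \sum_(k < i) T3 k (i - k.+1)%N (d.+2 - i.+1)%N =
    triangle_sum d (fun a b c => T3 a b c).
  transitivity (triangle_sum d (fun a b c => T3 b c a)); last first.
    by rewrite triangle_sum_swap12 triangle_sum_swap23.
  rewrite triangle_sumE [RHS](reindex_inj rev_ord_inj) big_ord_recl big_ord0 add0r.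
  apply: eq_bigr => i _ /=; have lt_i := ltn_ord i.
  rewrite (_ : d - (d.+1 - i.+1) = i)%N; last lia.
  apply: eq_bigr => k _; have lt_k := ltn_ord k.
  by congr (trace_mean (_ * power_sum N _ * power_sum N _)); rewrite /bump; lia.
by ring.
Qed.

Lemma trace_mean_rec k :
  (k + 4)%:R * T1 (k + 2)%N = 4%:R * N%:R * k.+1%:R * T1 k
    + k.+1%:R * k%:R * (k%:R - 1) * T1 (k - 2)%N.
Proof. by rewrite !trace_mean_power_sum // kernel_moment_rec. Qed.

Lemma trace_mean_odd k : T1 k.*2.+1 = 0.
Proof.
elim/ltn_ind: k => -[|k] IHk.
  by have := trace_mean_loop 0 (1 : {mpoly rat[N]}); rewrite mulr1 power_field1 raddf0 big_ord0 addr0.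
have nz : (k.*2.+1 + 4)%:R != 0 :> rat by rewrite addn4 pnatr_eq0.
apply: (mulfI nz); rewrite mulr0; have := trace_mean_rec k.*2.+1.
rewrite addn2 IHk // mulr0 add0r => ->.
case: k IHk {nz} => [|k] IHk; first by rewrite subrr mulr0 mul0r.
by rewrite doubleS subn2 IHk ?mulr0.
Qed.

(** A change of scale: the Harer-Zagier recurrence is homogeneous when N^(-2) marks
    the genus. *)
Lemma trace_mean_genus n : T1 (2 * n)%N = N%:R ^+ n.+1 * (genus_poly n).[N%:R ^- 2].
Proof.
have nzN : N%:R != 0 :> rat by rewrite pnatr_eq0 -lt0n.
elim/ltn_ind: n => -[|n] IHn.
  by rewrite muln0 power_sum0 -(rmorph_nat (@mpolyC N rat)) trace_meanC // hornerC mulr1.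
have nz : n.+2%:R != 0 :> rat by rewrite pnatr_eq0.
apply: (mulfI nz); rewrite [RHS]mulrCA.
rewrite horner_genus_polyS; have := trace_mean_rec (2 * n).
have -> : (2 * n + 2 = 2 * n.+1)%N by rewrite mulnSr.
have -> : (2 * n - 2 = 2 * n.-1)%N by rewrite -subn1 mulnBr.
have -> : (2 * n + 4 = 2 * n.+2)%N by rewrite -[n.+2]addn2 mulnDr.
rewrite natrM (IHn n) // => h; apply: (@mulfI _ 2%:R) => //; rewrite mulrA.
rewrite h; case: n {h nz} IHn => [|n] IHn.
  by rewrite !muln0 !mul0r; field.
rewrite IHn //= -[(2 * n.+1).+1]addn1 !natrD !natrM !exprS.
move: ((genus_poly n.+1).[_]) ((genus_poly n).[_]) (N%:R ^+ n) => u v w.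
by field.
Qed.

Definition joint_cumulant a b c : rat :=
  T3 a b c - T1 a * T2 b c - T1 b * T2 a c - T1 c * T2 a b + 2%:R * (T1 a * T1 b * T1 c).

(** A polygon without edges is a constant, independent of everything else. *)
Lemma joint_cumulant0 b c : joint_cumulant 0 b c = 0.
Proof.
rewrite /joint_cumulant -mulrA !trace_mean_power_sum0 -[power_sum N 0]mulr1 trace_mean_power_sum0.
by rewrite trace_mean1 //; ring.
Qed.

Lemma joint_cumulantC12 a b c : joint_cumulant a b c = joint_cumulant b a c.
Proof.
rewrite /joint_cumulant [power_sum N a * power_sum N b]mulrC.
set ab := trace_mean (_ * power_sum N a); set abc := trace_mean (_ * _ * _).
by ring.
Qed.

Lemma joint_cumulantC23 a b c : joint_cumulant a b c = joint_cumulant a c b.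
Proof.
rewrite /joint_cumulant [power_sum N b * power_sum N c]mulrC.
rewrite [power_sum N a * power_sum N b * power_sum N c]mulrAC.
set bc := trace_mean (_ * power_sum N b); set abc := trace_mean (_ * _ * _).
by ring.
Qed.

(** By trace_mean_loop1 a pair with d edges counts as one polygon with d + 2 edges, so
    the term of the convolution where this polygon has no edges is missing; it is the
    subtracted polynomial. *)
Lemma triangle_sum_pairs n :
  triangle_sum (2 * n) (fun a b c => T1 a * T2 b c) =
    N%:R ^+ n.+3 * (poly_convolution genus_poly genus_poly n.+1 - genus_poly n.+1).[N%:R ^- 2].
Proof.
rewrite triangle_sumE.
transitivity (\sum_(a < (2 * n).+1) T1 a * T1 (2 * n - a + 2)%N).
  by apply: eq_bigr => a _; rewrite trace_mean_loop1 mulr_sumr.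
rewrite (sum_even (F := fun a => T1 a * T1 (2 * n - a + 2)%N)); last first.
  by move=> k; rewrite trace_mean_odd mul0r.
rewrite /poly_convolution [X in (X - _).[_]]big_ord_recr /= subnn genus_poly0 mulr1 addrK horner_sum mulr_sumr.
apply: eq_bigr => i _; have lt_i := ltn_ord i.
rewrite (_ : 2 * n - 2 * i + 2 = 2 * (n.+1 - i))%N; last lia.
rewrite !trace_mean_genus hornerM mulrACA -exprD; congr (_ ^+ _ * _); lia.
Qed.

Lemma triangle_sum_triples n :
  triangle_sum (2 * n) (fun a b c => T1 a * T1 b * T1 c) =
    N%:R ^+ n.+3 *
      (poly_convolution genus_poly (poly_convolution genus_poly genus_poly) n).[N%:R ^- 2].
Proof.
have pairs k : \sum_(b < (2 * k).+1) T1 b * T1 (2 * k - b)%N =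
    N%:R ^+ k.+2 * (poly_convolution genus_poly genus_poly k).[N%:R ^- 2].
  rewrite (sum_even (F := fun b => T1 b * T1 (2 * k - b)%N)); last first.
    by move=> j; rewrite trace_mean_odd mul0r.
  rewrite /poly_convolution horner_sum mulr_sumr; apply: eq_bigr => i _; have lt_i := ltn_ord i.
  rewrite (_ : 2 * k - 2 * i = 2 * (k - i))%N; last lia.
  rewrite !trace_mean_genus hornerM mulrACA -exprD; congr (_ ^+ _ * _); lia.
rewrite triangle_sumE.
transitivity (\sum_(a < (2 * n).+1) T1 a * \sum_(b < (2 * n - a).+1) T1 b * T1 (2 * n - a - b)%N).
  by apply: eq_bigr => a _; rewrite mulr_sumr; apply: eq_bigr => b _; rewrite mulrA.
rewrite (sum_even (F := fun a => T1 a * \sum_(b < (2 * n - a).+1) T1 b * T1 (2 * n - a - b)%N)); last first.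
  by move=> k; rewrite trace_mean_odd mul0r.
rewrite [in RHS]/poly_convolution horner_sum mulr_sumr; apply: eq_bigr => i _; have lt_i := ltn_ord i.
rewrite (_ : 2 * n - 2 * i = 2 * (n - i))%N; last lia.
rewrite pairs trace_mean_genus hornerM mulrACA -exprD; congr (_ ^+ _ * _); lia.
Qed.

Definition three_face_poly n : {poly rat} :=
  genus_poly n.+2 + 2%:R *: genus_poly n.+1 - (n.+1%:R * (2 * n + 1)%:R) *: ('X * genus_poly n)
  - 3%:R *: poly_convolution genus_poly genus_poly n.+1
  + 2%:R *: poly_convolution genus_poly (poly_convolution genus_poly genus_poly) n.

Lemma triangle_sum_cumulant n :
  triangle_sum (2 * n) joint_cumulant = N%:R ^+ n.+3 * (three_face_poly n).[N%:R ^- 2].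
Proof.
have nzN : N%:R != 0 :> rat by rewrite pnatr_eq0 -lt0n.
transitivity (triangle_sum (2 * n) (fun a b c => T3 a b c)
  + (-3%:R) * triangle_sum (2 * n) (fun a b c => T1 a * T2 b c)
  + 2%:R * triangle_sum (2 * n) (fun a b c => T1 a * T1 b * T1 c)).
  have e1 : triangle_sum (2 * n) (fun a b c => T1 a * T2 b c) =
      triangle_sum (2 * n) (fun a b c => T1 b * T2 a c) by rewrite triangle_sum_swap12.
  have e2 : triangle_sum (2 * n) (fun a b c => T1 a * T2 b c) =
      triangle_sum (2 * n) (fun a b c => T1 c * T2 a b) by rewrite e1 triangle_sum_swap23.
  have -> : -3%:R = -1 - 1 - 1 :> rat by [].
  rewrite !mulrDl {2}e1 {2}e2 -!triangle_sumZ -!triangle_sumD.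
  by apply: eq_triangle_sum => a b c _; rewrite /joint_cumulant; ring.
rewrite triangle_sum_T3 triangle_sum_pairs triangle_sum_triples.
have -> : (2 * n + 2 = 2 * n.+1)%N by rewrite mulnSr.
have -> : (2 * n + 4 = 2 * n.+2)%N by rewrite -[n.+2]addn2 mulnDr.
rewrite !trace_mean_genus /three_face_poly.
rewrite !(hornerD, hornerN, hornerZ) hornerM hornerX.
have -> : ((2 * n).+1 * (2 * n).+2)%:R / 2%:R = n.+1%:R * (2 * n + 1)%:R :> rat.
  rewrite (_ : (2 * n).+1 * (2 * n).+2 = n.+1 * (2 * n + 1) * 2)%N; last lia.
  by rewrite !natrM mulfK.
move: (genus_poly n.+2).[_] (genus_poly n.+1).[_] (genus_poly n).[_] => u v w.
move: (poly_convolution _ _ _).[_] (poly_convolution _ _ _).[_] => p q.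
rewrite ![_ ^+ n.+3]exprS ![_ ^+ n.+2]exprS; field.
by [].
Qed.

End LoopSums.

(** * Gluings of polygons and their connected components *)

Section Polygons.
Variables (k : nat) (m : 'I_k -> nat).
Hypothesis m_gt0 : forall i, (0 < m i)%N.

Definition polygon (i : 'I_k) : {set edge m} := [set x | tag x == i].

Lemma card_polygon i : #|polygon i| = m i.
Proof.
have -> : polygon i = [set Tagged (fun i => 'I_(m i)) j | j in 'I_(m i)].
  apply/setP => -[i' j]; rewrite inE /=; apply/eqP/imsetP => [e|[j' _ e]].
    by subst i'; exists j.
  by have := congr1 (@tag _ _) e.
by rewrite card_imset ?card_ord // => j j' /eqP; rewrite eq_Tagged => /eqP.
Qed.

Lemma tag_tau x : tag (tau m x) = tag x.
Proof. by rewrite permE. Qed.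

(** From any edge the successor map reaches the whole polygon. *)
Lemma porbit_tau x : porbit (tau m) x = polygon (tag x).
Proof.
apply/eqP; rewrite eqEsubset; apply/andP; split.
  by apply: porbit_sub => [z|]; rewrite !inE // tag_tau.
have iter_tau n i (j : 'I_(m i)) : iter n (tau m) (Tagged (fun i => 'I_(m i)) j) =
    Tagged (fun i => 'I_(m i)) (iter n (@ordS _) j).
  by elim: n => //= n ->; rewrite permE.
have reach i (j : 'I_(m i)) : Tagged (fun i => 'I_(m i)) j \in
    porbit (tau m) (Tagged (fun i => 'I_(m i)) (Ordinal (m_gt0 i))).
  have -> : j = iter j (@ordS _) (Ordinal (m_gt0 i)).
    have val_iter n : (n < m i)%N -> iter n (@ordS _) (Ordinal (m_gt0 i)) = n :> nat.
      elim: n => //= n IHn lt_n; rewrite IHn ?modn_small //; exact: ltnW.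
    by apply: val_inj; rewrite /= val_iter.
  by rewrite -iter_tau -permX mem_porbit.
apply/subsetP => -[i' j']; rewrite inE /=; case: x => i j /= /eqP e; subst i'.
by rewrite (porbit_memE (reach i j)) reach.
Qed.

Lemma prod_porbits_tau (R : comNzRingType) (phi : {set edge m} -> R) (P : pred {set edge m}) :
  \prod_(O in porbits (tau m) | P O) phi O = \prod_(i | P (polygon i)) phi (polygon i).
Proof.
have -> : porbits (tau m) = polygon @: [set: 'I_k].
  apply/setP => O; apply/imsetP/imsetP => [[x _ ->]|[i _ ->]].
    by exists (tag x); rewrite ?inE ?porbit_tau.
  by exists (Tagged (fun i => 'I_(m i)) (Ordinal (m_gt0 i))); rewrite ?porbit_tau.
rewrite big_mkcondr big_imset /=; last first.
  move=> i j _ _ /setP/(_ (Tagged (fun i => 'I_(m i)) (Ordinal (m_gt0 i)))).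
  by rewrite !inE eqxx => /esym/eqP.
by rewrite -big_mkcondr; apply: eq_bigl => i; rewrite inE.
Qed.

Definition gluings : {set {perm edge m}} := [set iota | is_gluing iota].

Lemma gluingsP (iota : {perm edge m}) :
  reflect ((forall x, iota x != x) /\ (forall x, iota (iota x) = x)) (iota \in gluings).
Proof.
rewrite inE; apply: (iffP forallP) => [h|[h1 h2] x]; last by rewrite h1 h2 eqxx.
by split=> x; have /andP[h1 /eqP h2] := h x.
Qed.

(** The polygons of each class of g are glued among themselves, independently of the
    other classes. *)
Lemma gluing_sum_classes (I : finType) (g : 'I_k -> I) N : (0 < N)%N ->
  \sum_(iota in gluings | [forall x, g (tag (iota x)) == g (tag x)]) N%:R ^+ num_vertices iota =
    \prod_(c : I) trace_mean (\prod_(i | g i == c) power_sum N (m i)) :> rat.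
Proof.
move=> N_gt0; have := @pairing_sumE (edge m) I (fun x => g (tag x)) N N_gt0 setT (tau m).
rewrite /pairing_sum; move=> h; rewrite -[RHS](_ : \prod_(i : I) trace_mean (orbit_trace N (tau m) setT [set x | g (tag x) == i]) = _).
  rewrite -h; last by move=> x; rewrite tag_tau.
  apply: eq_bigl => iota; apply/andP/pairingsP => [[/gluingsP[h1 h2] /forallP h3]|[h1 h2 h3]].
    by split=> x; rewrite ?h2 ?inE ?(negbTE (h1 x)) //; apply/eqP.
  split; last by apply/forallP => x; rewrite h3.
  by apply/gluingsP; split=> x; rewrite ?h1 // h2 inE.
apply: eq_bigr => c _; congr trace_mean; rewrite /orbit_trace prod_porbits_tau.
apply: eq_big => [i|i _]; last by rewrite setIT card_polygon.
apply/subsetP/eqP => [/(_ (Tagged (fun i => 'I_(m i)) (Ordinal (m_gt0 i))))|gi x].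
  by rewrite !inE eqxx => /(_ isT)/eqP.
by rewrite !inE => /eqP->; rewrite gi.
Qed.

Definition stable_polygon (iota : {perm edge m}) i :=
  [forall x, (tag (iota x) == i) == (tag x == i)].

Definition base_edge i : edge m := Tagged (fun i => 'I_(m i)) (Ordinal (m_gt0 i)).

Lemma orbit_gluing_stable (iota : {perm edge m}) (S : {set edge m}) :
    (forall x, (iota x \in S) = (x \in S)) -> (forall x, (tau m x \in S) = (x \in S)) ->
  forall s, s \in <<[set iota; tau m]>>%g -> forall x, (s x \in S) = (x \in S).
Proof.
move=> stab_iota stab_tau s.
have sub : <<[set iota; tau m]>>%g \subset 'N(S | 'P)%g.
  rewrite gen_subG; apply/subsetP => t /set2P[] ->; apply/astabsP => x; rewrite /= apermE.
    exact: stab_iota.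
  exact: stab_tau.
by move=> /(subsetP sub)/astabsP stab x; have := stab x; rewrite /= apermE.
Qed.

Lemma connected_unstable (iota : {perm edge m}) i j : i != j ->
  glued_connected iota -> ~~ stable_polygon iota i.
Proof.
move=> ne_ij conn; apply/negP => /forallP stab.
have : base_edge j \in orbit 'P <<[set iota; tau m]>>%g (base_edge i).
  by rewrite (atransP conn (base_edge i) (in_setT _)) inE.
case/orbitP => s /(@orbit_gluing_stable _ (polygon i)) stab_s; rewrite /= apermE => eq_s.
have stab_iota x : (iota x \in polygon i) = (x \in polygon i) by rewrite !inE; exact: (eqP (stab x)).
have stab_tau x : (tau m x \in polygon i) = (x \in polygon i) by rewrite !inE tag_tau.
have := stab_s stab_iota stab_tau (base_edge i).
by rewrite eq_s !inE /= eqxx eq_sym (negbTE ne_ij).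
Qed.

End Polygons.

Local Notation o0 := (@ord0 2).
Local Notation o1 := (lift (@ord0 2) (@ord0 1)).
Local Notation o2 := (lift (@ord0 2) (lift (@ord0 1) (@ord0 0))).

Lemma ord3P (P : 'I_3 -> Prop) : P o0 -> P o1 -> P o2 -> forall i, P i.
Proof.
move=> P0 P1 P2 [[|[|[|//]]] lt_i].
- by rewrite (_ : Ordinal _ = o0) //; apply: val_inj.
- by rewrite (_ : Ordinal _ = o1) //; apply: val_inj.
by rewrite (_ : Ordinal _ = o2) //; apply: val_inj.
Qed.

(** Of two nonempty classes that partition three elements, one is a singleton. *)
Lemma ord3_class (P : pred 'I_3) i j : P i -> ~~ P j ->
  exists l b, forall i', (P i' == b) = (i' == l).
Proof.
move=> Pi nPj; have [b [l hl]] : exists b l, forall i', (P i' == b) = (i' == l); last by exists l, b.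
case e0: (P o0); case e1: (P o1); case e2: (P o2).
- by case/negP: nPj; move: j; apply: ord3P; rewrite ?e0 ?e1 ?e2.
- by exists false, o2; apply: ord3P; rewrite ?e0 ?e1 ?e2.
- by exists false, o1; apply: ord3P; rewrite ?e0 ?e1 ?e2.
- by exists true, o0; apply: ord3P; rewrite ?e0 ?e1 ?e2.
- by exists false, o0; apply: ord3P; rewrite ?e0 ?e1 ?e2.
- by exists true, o1; apply: ord3P; rewrite ?e0 ?e1 ?e2.
- by exists true, o2; apply: ord3P; rewrite ?e0 ?e1 ?e2.
by move: i Pi; apply: ord3P; rewrite ?e0 ?e1 ?e2.
Qed.

Section ThreePolygons.
Variables (m : 'I_3 -> nat).
Hypothesis m_gt0 : forall i, (0 < m i)%N.

(** A union of components that misses some polygon consists of one polygon or of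
    all but one. *)
Lemma unstable_connected (iota : {perm edge m}) : iota \in gluings m ->
  (forall i, ~~ stable_polygon iota i) -> glued_connected iota.
Proof.
move=> /gluingsP[_ iotaK] unstab; pose x0 := base_edge m_gt0 o0.
pose G := <<[set iota; tau m]>>%g; pose S := orbit 'P G x0.
have GS s : s \in G -> forall x, (s x \in S) = (x \in S).
  by move=> Gs x; rewrite -apermE; apply: orbit_actr.
have stab_iota x : (iota x \in S) = (x \in S).
  by apply: GS; rewrite mem_gen // !inE eqxx.
have stab_tau x : (tau m x \in S) = (x \in S).
  by apply: GS; rewrite mem_gen // !inE eqxx orbT.
apply/imsetP; exists x0; rewrite ?inE //; apply/esym/eqP; rewrite eqEsubset subsetT /=.
apply/subsetP => y _; apply: contraT => nSy.
have tagS x : (x \in S) = (base_edge m_gt0 (tag x) \in S).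
  have porb z : z \in S -> porbit (tau m) z \subset S.
    by apply: porbit_sub => {}z; rewrite stab_tau.
  apply/idP/idP => /porb; rewrite porbit_tau // => /subsetP; apply; by rewrite inE.
have [||l [b hl]] := @ord3_class (fun i => base_edge m_gt0 i \in S) (tag x0) (tag y).
- by rewrite -tagS; exact: orbit_refl.
- by rewrite -tagS.
case/negP: (unstab l); apply/forallP => x.
by rewrite -!hl -!tagS stab_iota.
Qed.

Definition respects_polygons (iota : {perm edge m}) := [forall x, tag (iota x) == tag x].

(** A disconnected gluing has either one polygon glued to itself and the two others
    to each other, or all three polygons glued to themselves: 1 - 1 = 0 and
    1 - 3 + 2 = 0. *)
Lemma connected_indicator (iota : {perm edge m}) : iota \in gluings m ->
  (glued_connected iota)%:R =
    1 - \sum_i (stable_polygon iota i)%:R + 2%:R * (respects_polygons iota)%:R :> rat.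
Proof.
move=> gl; rewrite !big_ord_recl big_ord0.
have resp_stable i : respects_polygons iota -> stable_polygon iota i.
  by move=> /forallP h; apply/forallP => x; rewrite (eqP (h x)).
have third i j l : (forall i', [|| i' == i, i' == j | i' == l]) -> i != l -> j != l ->
    stable_polygon iota i -> stable_polygon iota j -> stable_polygon iota l.
  move=> cov il jl /forallP hi /forallP hj; apply/forallP => x.
  have eqn y : (tag y == l) = ~~ ((tag y == i) || (tag y == j)).
    have [->|ne_l] := eqVneq (tag y) l; first by rewrite eq_sym (negbTE il) eq_sym (negbTE jl).
    by have := cov (tag y); rewrite (negbTE ne_l) orbF => ->.
  by rewrite !eqn (eqP (hi x)) (eqP (hj x)).
have all_resp : stable_polygon iota o0 -> stable_polygon iota o1 -> stable_polygon iota o2 ->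
    respects_polygons iota.
  move=> h0 h1 h2; apply/forallP => x.
  have : forall i, stable_polygon iota i by apply: ord3P.
  by move=> /(_ (tag x))/forallP/(_ x); rewrite eqxx eqb_id.
have conn_unst i : glued_connected iota -> ~~ stable_polygon iota i.
  have [j ne_ij] : exists j, i != j by move: i; apply: ord3P; [exists o1|exists o0|exists o0].
  exact: connected_unstable ne_ij.
have conn := unstable_connected gl.
have [h0|h0] := boolP (stable_polygon iota o0); have [h1|h1] := boolP (stable_polygon iota o1);
  have [h2|h2] := boolP (stable_polygon iota o2).
- have -> : glued_connected iota = false by apply/negP => /(conn_unst o0); rewrite h0.
  by rewrite all_resp.
- case/negP: h2; apply: (third o0 o1) => //; exact: ord3P.
- case/negP: h1; apply: (third o0 o2) => //; exact: ord3P.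
- have -> : glued_connected iota = false by apply/negP => /(conn_unst o0); rewrite h0.
  by rewrite (_ : respects_polygons _ = false) //; apply/negP => /(resp_stable o1); rewrite (negbTE h1).
- case/negP: h0; apply: (third o1 o2) => //; exact: ord3P.
- have -> : glued_connected iota = false by apply/negP => /(conn_unst o1); rewrite h1.
  by rewrite (_ : respects_polygons _ = false) //; apply/negP => /(resp_stable o0); rewrite (negbTE h0).
- have -> : glued_connected iota = false by apply/negP => /(conn_unst o2); rewrite h2.
  by rewrite (_ : respects_polygons _ = false) //; apply/negP => /(resp_stable o1); rewrite (negbTE h1).
rewrite conn; last by apply: ord3P.
by rewrite (_ : respects_polygons _ = false) //; apply/negP => /(resp_stable o1); rewrite (negbTE h1).
Qed.

(** The indicator expresses connected gluings through those that respect a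
    partition of the polygons, whose sums factor; the result is a joint cumulant. *)
Lemma connected_sum N : (0 < N)%N ->
  \sum_(iota in gluings m | glued_connected iota) N%:R ^+ num_vertices iota =
    joint_cumulant N (m o0) (m o1) (m o2).
Proof.
move=> N_gt0; have cl (I : finType) (g : 'I_3 -> I) := gluing_sum_classes m_gt0 g N_gt0.
have ifE (b : bool) (w : rat) : (if b then w else 0) = b%:R * w.
  by case: b; rewrite ?mul1r ?mul0r.
have all_gl := cl _ (fun=> tt); have stable_gl i := cl _ (fun j => j == i).
have resp_gl := cl _ id.
transitivity (\sum_(iota in gluings m) N%:R ^+ num_vertices iota
   - \sum_i \sum_(iota in gluings m | stable_polygon iota i) N%:R ^+ num_vertices iota
   + 2%:R * \sum_(iota in gluings m | respects_polygons iota) N%:R ^+ num_vertices iota : rat).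
  rewrite big_mkcondr [X in _ + 2%:R * X]big_mkcondr /= mulr_sumr.
  under [X in _ - X + _]eq_bigr do rewrite big_mkcondr.
  rewrite exchange_big /= -sumrB -big_split /=; apply: eq_bigr => iota gl.
  rewrite !ifE (eq_bigr _ (fun i _ => ifE _ _)) -mulr_suml (connected_indicator gl).
  by rewrite mulrDl mulrBl mul1r -mulrA.
have -> : \sum_(iota in gluings m) N%:R ^+ num_vertices iota =
    trace_mean (power_sum N (m o0) * power_sum N (m o1) * power_sum N (m o2)) :> rat.
  transitivity (\prod_(c : unit) trace_mean (\prod_(i : 'I_3 | tt == c) power_sum N (m i))).
    by rewrite -all_gl; apply: eq_bigl => iota; rewrite andbC; case: forallP => // -[].
  rewrite (big_pred1 tt); last by case.
  by rewrite !big_ord_recl big_ord0 mulr1 mulrA.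
have one i : \prod_(j : 'I_3 | (j == i) == true) power_sum N (m j) = power_sum N (m i).
  by rewrite (big_pred1 i) // => j; rewrite /= eqb_id.
have two (i i1 i2 : 'I_3) : i1 != i2 -> (forall j, (j != i) = (j == i1) || (j == i2)) ->
    \prod_(j : 'I_3 | (j == i) == false) power_sum N (m j) = power_sum N (m i1) * power_sum N (m i2).
  move=> ne_12 others; rewrite (bigD1 i1) /=; last by rewrite eqbF_neg others eqxx.
  rewrite (big_pred1 i2) // => j /=; rewrite eqbF_neg others.
  by have [->|] := eqVneq j i1; rewrite ?andbT // (negbTE ne_12).
have stable_val i i1 i2 : i1 != i2 -> (forall j, (j != i) = (j == i1) || (j == i2)) ->
    \sum_(iota in gluings m | stable_polygon iota i) N%:R ^+ num_vertices iota =
    trace_mean (power_sum N (m i)) * trace_mean (power_sum N (m i1) * power_sum N (m i2)) :> rat.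
  move=> ne_12 others; transitivity (\prod_(c : bool) trace_mean (\prod_(j | (j == i) == c) power_sum N (m j))).
    by rewrite -stable_gl.
  by rewrite big_bool one (two _ _ _ ne_12 others).
rewrite !big_ord_recl big_ord0 (@stable_val o0 o1 o2) ?(@stable_val o1 o0 o2) ?(@stable_val o2 o0 o1) //;
  try exact: ord3P.
have -> : \sum_(iota in gluings m | respects_polygons iota) N%:R ^+ num_vertices iota =
    trace_mean (power_sum N (m o0)) * trace_mean (power_sum N (m o1)) * trace_mean (power_sum N (m o2)) :> rat.
  transitivity (\prod_(c : 'I_3) trace_mean (\prod_(i : 'I_3 | i == c) power_sum N (m i))).
    by rewrite -resp_gl.
  by rewrite !big_ord_recl big_ord0 mulr1 mulrA !big_pred1_eq.
rewrite /joint_cumulant addr0 !opprD !addrA.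
by [].
Qed.

End ThreePolygons.

(** * Extracting the genus *)

Lemma poly_eq_on_nat (P R : {poly rat}) :
  (forall N, (0 < N)%N -> P.[N%:R] = R.[N%:R]) -> P = R.
Proof.
move=> eqPR; apply/eqP; rewrite -subr_eq0; apply: contraT => nz.
pose rs : seq rat := [seq i.+1%:R | i <- iota 0 (size (P - R))].
have uniq_rs : uniq rs.
  by rewrite map_inj_uniq ?iota_uniq // => i j /eqP; rewrite eqr_nat => /eqP[].
have root_rs : all (root (P - R)) rs.
  by apply/allP => _ /mapP[i _ ->]; rewrite rootE hornerD hornerN eqPR // subrr.
by have := max_poly_roots nz root_rs uniq_rs; rewrite size_map size_iota ltnn.
Qed.

(** After multiplication by a power of N both sides are polynomials in N, and
    polynomials that agree on all positive integers are equal. *)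
Lemma coef_of_scaled_values (P G : {poly rat}) k g : (2 * g <= k)%N ->
    (forall N, (0 < N)%N -> P.[N%:R] = N%:R ^+ k * G.[N%:R ^- 2]) ->
  P`_(k - 2 * g) = G`_g.
Proof.
(* M bounds g and the degree of G, so multiplying by N^(2 M) clears denominators. *)
move=> le_gk PG; pose M := (size G + g)%N.
have eqPG : P * 'X^(2 * M) = \sum_(j < M.+1) G`_j *: 'X^(k + 2 * (M - j)).
  apply: poly_eq_on_nat => N N_gt0; rewrite hornerM hornerXn (PG _ N_gt0) horner_sum.
  have nzN : N%:R != 0 :> rat by rewrite pnatr_eq0 -lt0n.
  rewrite (@horner_coef_wide _ M.+1); last by rewrite /M; lia.
  rewrite mulr_sumr mulr_suml; apply: eq_bigr => j _; rewrite hornerZ hornerXn.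
  have le_jM : (j <= M)%N by rewrite -ltnS.
  have -> : (2 * M = 2 * j + 2 * (M - j))%N by rewrite -mulnDr subnKC.
  have nz2 : N%:R ^+ 2 ^+ j != 0 :> rat by rewrite !expf_neq0.
  rewrite (exprD _ (2 * j)) (exprD _ k) (exprM _ 2 j) exprVn.
  move: (_ ^+ j) nz2 (_ ^+ k) (_ ^+ (2 * (M - j))) => u nz_u v w.
  by field.
have := congr1 (fun q : {poly rat} => q`_(k - 2 * g + 2 * M)) eqPG.
rewrite coefMXn ltnNge leq_addl /= addnK coef_sum => ->.
have lt_gM : (g < M.+1)%N by rewrite /M; lia.
rewrite (bigD1 (Ordinal lt_gM)) //= big1 => [|j]; last first.
  rewrite -val_eqE /= => ne_jg; rewrite coefZ coefXn.
  by have := ltn_ord j; case: eqP => [e|_ _]; rewrite ?mulr0 //; move/eqP: ne_jg; lia.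
by rewrite addr0 coefZ coefXn (_ : _ == _) ?mulr1 //; apply/eqP; rewrite /M; lia.
Qed.

(** Sizes 0 may be allowed in the sum when they contribute nothing. *)
Lemma sum_positive_triples d (F : nat -> nat -> nat -> rat) :
    (forall b c, F 0%N b c = 0) -> (forall a c, F a 0%N c = 0) -> (forall a b, F a b 0%N = 0) ->
  \sum_(m : {ffun 'I_3 -> 'I_d.+1} | [forall i, (0 < m i)%N] && (\sum_(i < 3) m i == d)%N)
     F (m o0) (m o1) (m o2) = triangle_sum d F.
Proof.
move=> F1 F2 F3; rewrite /triangle_sum pair_big /= pair_big_dep /=.
pose h (m : {ffun 'I_3 -> 'I_d.+1}) := ((m o0, m o1), m o2).
pose g (p : 'I_d.+1 * 'I_d.+1 * 'I_d.+1) : {ffun 'I_3 -> 'I_d.+1} :=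
  [ffun i => if i == o0 then p.1.1 else if i == o1 then p.1.2 else p.2].
have hK : cancel h g.
  by move=> m; apply/ffunP; apply: ord3P; rewrite ffunE.
have gK : cancel g h by move=> [[a b] c]; rewrite /h !ffunE.
rewrite [RHS](reindex h) /=; last by exists g => ? _.
rewrite [RHS](bigID (fun m : {ffun 'I_3 -> 'I_d.+1} => [forall i, (0 < m i)%N])) /=.
rewrite [X in _ + X]big1 ?addr0 => [|m /andP[_]]; last first.
  rewrite negb_forall => /existsP[i]; rewrite -eqn0Ngt => /eqP.
  by move: i; apply: ord3P => ->.
by apply: eq_bigl => m; rewrite andbC !big_ord_recl big_ord0 addn0 addnA.
Qed.

Theorem corollary4 (n : nat) :
  (epsilon 1 n 3)%:R =
    (808%:R * n%:R ^+ 2 + 99%:R * n%:R - 454%:R) / 3003%:R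
      * 'C(2 * n + 1, n)%:R * 'C(n + 1, 5)%:R :> rat.
Proof.
have half_n : (2 * n)./2 = n by rewrite mul2n doubleK.
have [lt_n3|le_3n] := ltnP n 3.
  have -> : 'C(n + 1, 5) = 0%N by rewrite bin_small // addn1 ltnS (leq_trans lt_n3).
  rewrite mulr0.
  rewrite /epsilon; case: eqP => [_|_] //.
  rewrite big1 // => m /andP[_ /eqP sum_m]; apply/eqP; rewrite cards_eq0; apply/eqP/setP => iota.
  rewrite inE in_set0; apply/negP => /and3P[_ _ /eqP]; rewrite sum_m half_n; lia.
pose size_ok (m : {ffun 'I_3 -> 'I_(2 * n).+1}) :=
  [forall i, (0 < m i)%N] && (\sum_(i < 3) m i == 2 * n)%N.
pose P : {poly rat} := \sum_(m | size_ok m)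
  \sum_(iota in gluings (fun i => m i : nat) | glued_connected iota) 'X^(num_vertices iota).
(* A connected gluing of genus h has n - 1 - 2 h = n + 3 - 2 (h + 2) vertices, so
   genus 1 is the degree 3 in N^(-2). *)
have -> : (epsilon 1 n 3)%:R = P`_(n.+3 - 2 * 3).
  rewrite /epsilon (_ : (n == 0)%N = false); last by lia.
  rewrite natr_sum coef_sum; apply: eq_bigr => m /andP[_ /eqP sum_m].
  rewrite coef_sum /epsilon_polygons sum_m half_n -sum1_card natr_sum.
  rewrite (eq_bigl (fun iota => ((iota \in gluings (fun i => m i : nat)) && glued_connected iota)
     && (num_vertices iota == n.+3 - 2 * 3)%N)); last first.
    move=> iota; rewrite !inE -andbA; congr [&& _, _ & _].
    by move: (num_vertices iota) => v; clear -le_3n; apply/eqP/eqP; lia.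
  by rewrite big_mkcondr; apply: eq_bigr => iota _; rewrite coefXn eq_sym; case: eqP.
rewrite (@coef_of_scaled_values _ (three_face_poly n)); last 2 first.
- by lia.
- move=> N N_gt0; rewrite -triangle_sum_cumulant // -sum_positive_triples.
  + rewrite horner_sum; apply: eq_bigr => m /andP[/forallP m_gt0 _].
    rewrite -(@connected_sum (fun i => m i : nat)) //.
    by rewrite horner_sum; apply: eq_bigr => iota _; rewrite hornerXn.
  + by move=> b c; exact: joint_cumulant0.
  + by move=> a c; rewrite joint_cumulantC12; exact: joint_cumulant0.
  by move=> a b; rewrite joint_cumulantC23 joint_cumulantC12; exact: joint_cumulant0.
rewrite -three_faces_genus1 /three_face_poly.
rewrite !(coefD, coefN, coefZ) coefXM /= /genus_count.
ring.
Qed.
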